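(* Fix $p\in(0,1)$, $\xi\ge0$ and $(s,t)\in\mathbb R_+^2$. Define $$\Delta=\Delta_{p,s,t,\xi}=p(1-p)(e^\xi+e^{-\xi}-2)\big[p(1-p)(s+t)^2(e^\xi+e^{-\xi}-2)+4st\big].$$ Then the convex dual $J^*_{s,t}(\xi)=\sup_{r\in\mathbb R}\{r\xi-J_{s,t}(r)\}$ is given as follows. If $t<\frac{1-p}{p}s$, $$\begin{aligned}J^*_{s,t}(\xi)={}&s\log\frac{p(1-p)(s+t)(e^\xi+e^{-\xi}-2)+2s+\sqrt{\Delta}}{2s\,(1-p(1-e^{-\xi}))}\\&+t\log\frac{\big[p(1-p)(s+t)(e^\xi+e^{-\xi}-2)+\sqrt{\Delta}\big](1-p(1-e^{-\xi}))}{p(1-p)(t-s)(e^\xi+e^{-\xi}-2)+\sqrt{\Delta}},\end{aligned}$$ and if $t\ge\frac{1-p}{p}s$, then $J^*_{s,t}(\xi)=s\xi$.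
   Context: Here $\mathbb R_+=[0,\infty)$ and $\mathbb Z_+=\{0,1,2,\dots\}$. Let $\{\omega_v\}_{v\in\mathbb Z_+^2}$ be i.i.d. Bernoulli($p$) random variables with values in $\{0,1\}$ and $\mathbb P\{\omega_v=1\}=p$. An admissible path from $v$ to $w$ is a sequence $v=v_0,\dots,v_k=w$ in $\mathbb Z_+^2$ with $v_{i+1}-v_i\in\{e_1,e_2\}$. The last passage time is $G_{v,w}=\max_{\pi}\sum_{i}\omega_{v_{i+1}}\mathbf 1\{v_{i+1}-v_i=e_1\}$ (maximum over admissible paths from $v$ to $w$), and $G_{m,n}=G_{(0,0),(m,n)}$. Right-tail rate function: for $s,t>0$ and $r<s$, $J_{s,t}(r)=-\lim_{N\to\infty}N^{-1}\log\mathbb P\{G_{\lfloor Ns\rfloor,\lfloor Nt\rfloor}\ge Nr\}$ (the limit exists and equals $0$ for $r\le 0$). As a function of $(s,t,r)$ it is extended continuously to $\{s,t\ge0,\ r\le s\}$ and set equal to $+\infty$ elsewhere, so that it is a lower semicontinuous convex function on $\mathbb R^3$. *)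

(* Defs.v *)
From mathcomp Require Export all_boot all_order all_algebra.
From mathcomp Require Export all_classical all_reals all_analysis.
Export Order.TTheory GRing.Theory Num.Theory.
Export numFieldNormedType.Exports.

Set Implicit Arguments.
Unset Strict Implicit.
Unset Printing Implicit Defensive.

Local Open Scope classical_set_scope.
Local Open Scope ring_scope.

Definition mutually_independent d d' (T : measurableType d)
    (T' : measurableType d') (R : realType) (P : probability T R)
    (I : choiceType) (X : I -> {RV P >-> T'}) : Prop :=
  forall (s : seq I) (B : I -> set T'), uniq s ->
    (forall i, i \in s -> measurable (B i)) ->
    P (\bigcap_(i in [set` s]) (X i @^-1` B i)) =
      (\prod_(i <- s) P (X i @^-1` B i))%E.

Definition iid_bernoulli d (T : measurableType d) (R : realType)
    (P : probability T R) (p : R) (omega : nat * nat -> {RV P >-> bool})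
    : Prop :=
  mutually_independent omega /\
  forall v, P [set x | omega v x = true] = p%:E.

Definition horizontal_step (u v : nat * nat) : bool := v == (u.1.+1, u.2).
Definition vertical_step (u v : nat * nat) : bool := v == (u.1, u.2.+1).

(* The path v = v_0, v_1, ..., v_k = w is represented by v and the sequence
   [:: v_1; ...; v_k]. *)
Definition admissible (v w : nat * nat) (vs : seq (nat * nat)) : bool :=
  path (fun x y => horizontal_step x y || vertical_step x y) v vs
  && (last v vs == w).

Definition path_weight (omega : nat * nat -> bool) (v : nat * nat)
    (vs : seq (nat * nat)) : nat :=
  sumn (pairmap (fun x y => horizontal_step x y * omega y)%N v vs).

(* An admissible path to w = (m, n) stays in [0, m] x [0, n], and its number of
   steps is determined by its endpoints, so the tuples below range over all
   admissible paths from v to w: see passage_time_ge and passage_time_attained. *)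
Definition passage_time (omega : nat * nat -> bool) (v w : nat * nat) : nat :=
  \max_(vs : ((w.1 - v.1) + (w.2 - v.2)).-tuple ('I_w.1.+1 * 'I_w.2.+1)
         | admissible v w [seq (val x.1, val x.2) | x <- vs])
    path_weight omega v [seq (val x.1, val x.2) | x <- vs].

Lemma admissible_bounds v w vs : admissible v w vs ->
  [/\ (v.1 <= w.1)%N, (v.2 <= w.2)%N,
      size vs = ((w.1 - v.1) + (w.2 - v.2))%N
    & all (fun x => (x.1 <= w.1) && (x.2 <= w.2))%N vs].
Proof.
elim: vs v => [|x vs IH] v; first by case/andP=> _ /eqP /= <-; rewrite !subnn.
move=> /andP[/= /andP[vx pvs] l].
have /IH[x1 x2 sz al] : admissible x w vs by rewrite /admissible pvs.
rewrite x1 x2 al sz.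
case/orP: vx => /eqP vx; move: x1 x2; rewrite vx /= => x1 x2; split => //.
- exact: ltnW.
- by rewrite -addSn subnSK.
- exact: ltnW.
- by rewrite -addnS subnSK.
Qed.

Lemma admissible_tuple v w vs : admissible v w vs ->
  exists us : ((w.1 - v.1) + (w.2 - v.2)).-tuple ('I_w.1.+1 * 'I_w.2.+1),
    [seq (val x.1, val x.2) | x <- us] = vs.
Proof.
move=> /admissible_bounds[_ _ /eqP sz /allP al].
pose us := [seq ((inord x.1 : 'I_w.1.+1), (inord x.2 : 'I_w.2.+1)) | x <- vs].
have sus : size us == ((w.1 - v.1) + (w.2 - v.2))%N by rewrite size_map.
exists (Tuple sus).
rewrite /= -map_comp -[RHS]map_id; apply/eq_in_map => x /al /andP[x1 x2] /=.
by rewrite !inordK // -surjective_pairing.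
Qed.

Lemma passage_time_ge omega v w vs : admissible v w vs ->
  (path_weight omega v vs <= passage_time omega v w)%N.
Proof.
move=> avs; have [us E] := admissible_tuple avs; rewrite -E in avs *.
exact: (@bigop.leq_bigmax_cond _
  (fun us => admissible v w [seq (val x.1, val x.2) | x <- val us])
  (fun us => path_weight omega v [seq (val x.1, val x.2) | x <- val us]) us).
Qed.

Lemma admissible_exists v w : (v.1 <= w.1)%N -> (v.2 <= w.2)%N ->
  exists vs, admissible v w vs.
Proof.
move=> v1 v2.
have [k ek] : exists k, k = ((w.1 - v.1) + (w.2 - v.2))%N by eexists.
elim: k v v1 v2 ek => [|k IH] v v1 v2 ek.
  exists [::]; rewrite /admissible /= -pair_eqE /= !eqn_leq v1 v2 /=.
  by move/esym/eqP: ek; rewrite addn_eq0 !subn_eq0.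
have [lt1|ge1] := ltnP v.1 w.1.
  have [//|//||vs avs] := IH (v.1.+1, v.2).
    by apply: succn_inj; rewrite ek /= -addSn subnSK.
  by exists ((v.1.+1, v.2) :: vs); rewrite /admissible /= /horizontal_step eqxx.
have lt2 : (v.2 < w.2)%N.
  by rewrite -subn_gt0; move: ek; rewrite (eqP ge1) add0n => <-.
have [//|//||vs avs] := IH (v.1, v.2.+1).
  by apply: succn_inj; rewrite ek /= -addnS subnSK.
by exists ((v.1, v.2.+1) :: vs); rewrite /admissible /= /vertical_step eqxx orbT.
Qed.

Lemma passage_time_attained omega v w :
    (v.1 <= w.1)%N -> (v.2 <= w.2)%N ->
  exists2 vs, admissible v w vs & path_weight omega v vs = passage_time omega v w.
Proof.
move=> v1 v2; have [vs avs] := admissible_exists v1 v2.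
have [us E] := admissible_tuple avs; rewrite -E in avs.
pose A := [pred us : ((w.1 - v.1) + (w.2 - v.2)).-tuple ('I_w.1.+1 * 'I_w.2.+1)
          | admissible v w [seq (val x.1, val x.2) | x <- us]].
have A0 : (0 < #|A|)%N by apply/card_gt0P; exists us.
have [us' aus' eq_us'] := eq_bigmax_cond
  (fun us => path_weight omega v [seq (val x.1, val x.2) | x <- val us]) A0.
by exists [seq (val x.1, val x.2) | x <- us'].
Qed.

(* J is the right-tail rate function of the model: the three conditions
   determine J, the second one because the region where the first one applies
   is dense in the closed one. *)
Record right_tail_rate d (T : measurableType d) (R : realType)
    (P : probability T R) (omega : nat * nat -> {RV P >-> bool})
    (J : R -> R -> R -> \bar R) : Prop := RightTailRate {
  right_tail_rate_lim : forall s t r : R, 0 < s -> 0 < t -> r < s ->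
    (fun N : nat =>
       (- (N%:R^-1)%:E * lne (P [set x | (N%:R * r <=
          (passage_time (fun v => omega v x) (0, 0)
             (Num.truncn (N%:R * s), Num.truncn (N%:R * t)))%:R)%R]))%E)
      @ \oo --> J s t r;
  right_tail_rate_continuous :
    {within [set x : R * R * R | [/\ 0 <= x.1.1, 0 <= x.1.2 & x.2 <= x.1.1]],
      continuous (fun x : R * R * R => J x.1.1 x.1.2 x.2)};
  right_tail_rate_pinfty : forall s t r : R,
    ~ [/\ 0 <= s, 0 <= t & r <= s] -> J s t r = +oo%E
}.

Definition convex_dual (R : realType) (f : R -> \bar R) (xi : R) : \bar R :=
  ereal_sup [set ((r * xi)%:E - f r)%E | r in [set: R]].

Definition Delta (R : realType) (p s t xi : R) : R :=
  p * (1 - p) * (expR xi + expR (- xi) - 2) *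
  (p * (1 - p) * (s + t) ^+ 2 * (expR xi + expR (- xi) - 2) + 4 * s * t).

(* Main.v *)
Require Import Defs.
From mathcomp Require Import ring lra.

(** Along a path each column contributes at most one weight, so that the heights
    G(., j) of a row have increments in {0, 1}, and the next row is obtained as
    in a queue: the weights are arrivals, the old increments are services, and
    the vertical increment of G is the queue length.  Hence the model has
    stationary versions: for p < u <= 1, a row of independent Bernoulli(u)
    increments is preserved when each row receives at its left end an
    independent geometric amount of parameter q = p (1 - u) / (u (1 - p)).  This
    is Burke's theorem, [burke_row].

    Let a(u) be the logarithm of the moment generating function of Bernoulli(u)
    at xi, and -b(u) the one of the geometric law at -xi.  Comparing the model
    with its stationary version in both directions gives, for the mean D(m, l)
    of exp (xi G) over m columns and l rows,

      D(m, l) <= exp (m a(u) + l b(u))                       [rows_mean_upper]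
      exp (m a(u)) <= exp (xi m - n b(u))
                      + sum_(l < n) exp (- l b(u)) D(m, l+1) [rows_mean_lower]

    The first bound holds because inflow only raises heights; the second one
    decomposes an optimal path at its last exit from the left boundary.  With
    the first bound at other parameters, the terms of the sum whose number of
    rows is not the right one for u are negligible, so that the remaining one
    is as large as it can be ([rows_mean_growth]).  Thus log D(N s, N t) / N
    tends to the infimum of s a(u) + t b(u) over u.

    The exponential Markov inequality and Laplace's principle on finitely many
    levels turn this into the convex dual of the rate function ([dual_le],
    [dual_ge]); the continuity of J supplies the boundary values.  It remains to
    minimize.  The critical point equation is quadratic in u, with discriminant
    a multiple of Delta, and its larger root lies in [p, 1) exactly when
    t < (1 - p) / p * s; otherwise the minimum is at u = 1, where a(1) = xi and
    b(1) = 0. *)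

Set Implicit Arguments.
Unset Strict Implicit.
Unset Printing Implicit Defensive.

Local Open Scope ring_scope.

(** * Means over independent bits *)

Section BernoulliMean.
Context (R : realType).
Implicit Types (p c : R) (F G : seq bool -> R).

(** The mean of [F] over words of [m] independent bits.  Defining it by recursion
    on [m] makes Burke's theorem below an induction on the row, and avoids Fubini. *)
Fixpoint bern_mean p m F : R :=
  if m is m'.+1 then
    p * bern_mean p m' (fun r => F (true :: r))
    + (1 - p) * bern_mean p m' (fun r => F (false :: r))
  else F [::].

Lemma eq_bern_mean p m F G : (forall r, size r = m -> F r = G r) ->
  bern_mean p m F = bern_mean p m G.
Proof.
elim: m F G => [|m IH] F G FG /=; first exact: FG.
by congr (_ * _ + _ * _); apply: IH => r rm; apply: FG; rewrite /= rm.
Qed.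

Lemma bern_mean_le p m F G : 0 <= p <= 1 ->
  (forall r, size r = m -> F r <= G r) ->
  bern_mean p m F <= bern_mean p m G.
Proof.
move=> /andP[p0 p1]; elim: m F G => [|m IH] F G FG /=; first exact: FG.
by rewrite lerD// ler_wpM2l ?subr_ge0// IH// => r rm; apply: FG; rewrite /= rm.
Qed.

Lemma bern_mean_cst p m c : bern_mean p m (fun=> c) = c.
Proof. by elim: m => //= m ->; ring. Qed.

Lemma bern_meanD p m F G :
  bern_mean p m (fun r => F r + G r) = bern_mean p m F + bern_mean p m G.
Proof. by elim: m F G => //= m IH F G; rewrite !IH; ring. Qed.

Lemma bern_meanZ p m c F :
  bern_mean p m (fun r => c * F r) = c * bern_mean p m F.
Proof. by elim: m F => //= m IH F; rewrite !IH; ring. Qed.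

Lemma bern_mean_sum p m K (F : nat -> seq bool -> R) :
  bern_mean p m (fun r => \sum_(k < K) F k r) = \sum_(k < K) bern_mean p m (F k).
Proof.
elim: K => [|K IH]; last first.
  rewrite big_ord_recr /= -IH -bern_meanD.
  by apply: eq_bern_mean => r _; rewrite big_ord_recr.
rewrite big_ord0 -[RHS](bern_mean_cst p m).
by apply: eq_bern_mean => r _; rewrite big_ord0.
Qed.

Lemma bern_mean_cat p m n F : bern_mean p (m + n) F =
  bern_mean p m (fun r => bern_mean p n (fun r' => F (r ++ r'))).
Proof. by elim: m F => [//|m IH] F; rewrite addSn /= !IH. Qed.

End BernoulliMean.

(** * The evolution of one row *)

Section RowStep.
Context (R : realType).
Implicit Types (g v x y : R) (h k : seq R) (w : seq bool).

(** One row of the recursion G(x, j) = max (G(x-1, j) + omega(x, j), G(x, j-1)):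
    [h] lists the heights of row j-1 at x = 1, 2, ..., [w] the weights of row j, and
    [g] is the new height at x = 0.  Heights are real, so that a row can be shifted
    down by the amount that enters at the left boundary. *)
Fixpoint row_step g h w : seq R :=
  match h, w with
  | y :: h', b :: w' =>
      Num.max (g + b%:R) y :: row_step (Num.max (g + b%:R) y) h' w'
  | _, _ => [::]
  end.

Lemma size_row_step g h w : size w = size h -> size (row_step g h w) = size h.
Proof. by elim: h w g => [|y h IH] [|b w] g //= [/IH->]. Qed.

Definition shift v h := [seq y - v | y <- h].

Lemma size_shift v h : size (shift v h) = size h.
Proof. exact: size_map. Qed.

Definition dominates h k := all2 (fun y x => x <= y) h k.

(** The pointwise bound [h <= max (k, l)].  It turns the sublinearity of the
    max-plus evolution into an inequality between means (see [rows_mean_le_add]). *)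
Fixpoint below_max h k l :=
  match h, k, l with
  | [::], [::], [::] => true
  | y :: h', x :: k', z :: l' => (y <= Num.max x z) && below_max h' k' l'
  | _, _, _ => false
  end.

Lemma dominates_refl h : dominates h h.
Proof. by elim: h => //= y h ->; rewrite lexx. Qed.

Lemma dominates_size h k : dominates h k -> size h = size k.
Proof. by elim: h k => [|y h IH] [|x k] //= /andP[_ /IH->]. Qed.

Lemma dominates_row_step g g' h h' w : g' <= g -> size w = size h ->
  dominates h h' -> dominates (row_step g h w) (row_step g' h' w).
Proof.
elim: h h' w g g' => [|y h IH] [|y' h'] [|b w] g g' //= gg [sw] /andP[yy hh].
have le : Num.max (g' + b%:R) y' <= Num.max (g + b%:R) y.
  by rewrite ge_max !le_max lerD2r gg yy orbT.
by rewrite le /= IH.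
Qed.

Lemma row_step_shift v g h w :
  row_step (g - v) (shift v h) w = shift v (row_step g h w).
Proof.
elim: h w g => [|y h IH] [|b w] g //=.
have -> : Num.max (g - v + b%:R) (y - v) = Num.max (g + b%:R) y - v.
  by rewrite addrAC -addr_maxl.
by rewrite IH.
Qed.

(** A row step is max-plus linear in the pair (left height, previous row). *)
Lemma below_max_row_step h k l w (f g g' : R) : f <= Num.max g g' ->
  size w = size h -> below_max h k l ->
  below_max (row_step f h w) (row_step g k w) (row_step g' l w).
Proof.
elim: h k l w f g g' => [|y h IH] [|x k] [|z l] [|b w] f g g' //= fg [sw].
move=> /andP[yxz hkl].
suff le : Num.max (f + b%:R) y <=
    Num.max (Num.max (g + b%:R) x) (Num.max (g' + b%:R) z).
  by rewrite le /= IH.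
by move: fg yxz; rewrite ge_max !le_max !lerD2r => /orP[] -> /orP[] ->;
  rewrite ?orbT.
Qed.

Lemma below_max_size h k l : below_max h k l ->
  size h = size k /\ size h = size l.
Proof.
elim: h k l => [|y h IH] [|x k] [|z l] //= /andP[_ /IH[sk sl]].
by rewrite -sk -sl.
Qed.

Lemma below_max_id h k : size h = size k -> below_max h h k.
Proof. by elim: h k => [|y h IH] [|x k] //= [/IH->]; rewrite le_max lexx. Qed.

Lemma last_shift v h : last (- v) (shift v h) = last 0 h - v.
Proof. by have := last_map (fun y => y - v) h 0; rewrite /= sub0r. Qed.

Lemma dominates_last h k x y : x <= y -> dominates h k ->
  last x k <= last y h.
Proof.
by elim: h k x y => [|y h IH] [|x k] //= a b _ /andP[xy]; apply: IH.
Qed.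

Lemma below_max_last h k l x y z : x <= Num.max y z -> below_max h k l ->
  last x h <= Num.max (last y k) (last z l).
Proof.
elim: h k l x y z => [|x h IH] [|y k] [|z l] //= a b c _ /andP[xyz].
exact: IH.
Qed.

End RowStep.

(** * Exponential moments over several rows *)

Section RowsMean.
Context (R : realType) (p : R).
Implicit Types (v : R) (h k l : seq R) (Phi : seq R -> R).
Hypothesis p01 : 0 <= p <= 1.

(** The mean of [Phi] over the heights after [n] fresh rows of weights, started
    from [h] and with left boundary height 0; from the zero row this is the law of
    the passage time over [n] rows. *)
Fixpoint rows_mean n Phi h : R :=
  if n is n'.+1 then
    bern_mean p (size h) (fun w => rows_mean n' Phi (row_step 0 h w))
  else Phi h.

Lemma rows_mean_le n Phi Psi h :
  (forall k, size k = size h -> Phi k <= Psi k) ->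
  rows_mean n Phi h <= rows_mean n Psi h.
Proof.
elim: n h => [|n IH] h le /=; first exact: le.
by apply: bern_mean_le => // w sw; apply: IH => k; rewrite size_row_step// => /le.
Qed.

Lemma rows_meanZ n c Phi h :
  rows_mean n (fun k => c * Phi k) h = c * rows_mean n Phi h.
Proof.
elim: n h => //= n IH h.
by under eq_bern_mean do rewrite IH; rewrite bern_meanZ.
Qed.

Lemma rows_mean_sum n K (Phi : nat -> seq R -> R) h :
  rows_mean n (fun k => \sum_(i < K) Phi i k) h
    = \sum_(i < K) rows_mean n (Phi i) h.
Proof.
elim: n h => //= n IH h.
under eq_bern_mean do rewrite IH.
exact: (bern_mean_sum _ _ _ (fun i w => rows_mean n (Phi i) (row_step 0 h w))).
Qed.

Variable (xi : R).
Hypothesis xi0 : 0 <= xi.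

Definition exp_last h : R := expR (xi * last 0 h).

Lemma exp_last_ge h k v : 0 <= v -> dominates h (shift v k) ->
  expR (- (xi * v)) * exp_last k <= exp_last h.
Proof.
move=> v0 hk; rewrite -expRD ler_expR addrC -mulrBr ler_wpM2l//.
by rewrite -last_shift dominates_last// oppr_le0.
Qed.

Lemma exp_last_le_add h k l v : 0 <= v -> below_max h (shift v k) l ->
  exp_last h <= expR (- (xi * v)) * exp_last k + exp_last l.
Proof.
move=> v0 hkl.
have : last 0 h <= Num.max (last (- v) (shift v k)) (last 0 l).
  by apply: below_max_last => //; rewrite le_max lexx orbT.
rewrite last_shift -expRD /exp_last => le.
have [le'|le'] := leP (last 0 l) (last 0 k - v).
  apply: ler_wpDr; first exact: expR_ge0.
  rewrite ler_expR addrC -mulrBr ler_wpM2l//.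
  by move: le; rewrite max_l.
apply: ler_wpDl; first exact: expR_ge0.
by rewrite ler_expR ler_wpM2l//; move: le; rewrite max_r// ltW.
Qed.

(** Lowering the left boundary by [v] relative to the starting row costs at most
    the factor [expR (- (xi * v))], since a row step commutes with constants and is
    monotone. *)
Lemma rows_mean_ge n h k v : 0 <= v -> dominates h (shift v k) ->
  expR (- (xi * v)) * rows_mean n exp_last k <= rows_mean n exp_last h.
Proof.
move=> v0; elim: n h k => [|n IH] h k hk /=; first exact: exp_last_ge.
have /esym sk := dominates_size hk; rewrite size_shift in sk; rewrite sk.
rewrite -bern_meanZ; apply: bern_mean_le => // w sw; apply: IH.
rewrite -row_step_shift; apply: dominates_row_step => //.
by rewrite sub0r oppr_le0.
Qed.

(** A path to the last column either starts on the shifted row [k] or on [l];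
    the exponential of the larger of the two values is at most the sum of the two
    exponentials. *)
Lemma rows_mean_le_add n h k l v : 0 <= v -> below_max h (shift v k) l ->
  rows_mean n exp_last h <=
    expR (- (xi * v)) * rows_mean n exp_last k + rows_mean n exp_last l.
Proof.
move=> v0; elim: n h k l => [|n IH] h k l hkl /=; first exact: exp_last_le_add.
have [sk sl] := below_max_size hkl; rewrite size_shift in sk.
rewrite -sk -sl -bern_meanZ -bern_meanD; apply: bern_mean_le => // w sw.
apply: IH; rewrite -row_step_shift; apply: below_max_row_step => //.
by rewrite le_max lexx orbT.
Qed.

Lemma rows_mean_mono n h k : dominates h k ->
  rows_mean n exp_last k <= rows_mean n exp_last h.
Proof.
move=> hk; have := @rows_mean_ge n h k 0 (lexx _).
rewrite mulr0 oppr0 expR0 mul1r; apply.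
by rewrite /shift (eq_map (@subr0 _)) map_id.
Qed.

Lemma rows_mean_ge0 n h : 0 <= rows_mean n exp_last h.
Proof.
elim: n h => [|n IH] h /=; first exact: expR_ge0.
by rewrite -(bern_mean_cst p (size h) 0); apply: bern_mean_le.
Qed.

Definition flat m : seq R := nseq m 0.

Lemma row_step_ge0 m w : size w = m -> dominates (row_step 0 (flat m) w) (flat m).
Proof.
suff H g : 0 <= g -> size w = m -> dominates (row_step g (flat m) w) (flat m).
  exact: H.
elim: m w g => [|m IH] [|b w] g //= g0 [sw].
by rewrite le_max lexx orbT /= IH// le_max lexx orbT.
Qed.

Lemma rows_mean_flat_nondecreasing m :
  {homo (fun n => rows_mean n exp_last (flat m)) : n n' / (n <= n')%N >-> n <= n'}.
Proof.
apply: homo_leq; [exact: lexx|exact: le_trans|move=> n /=].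
rewrite size_nseq -[leLHS](bern_mean_cst p m); apply: bern_mean_le => // w sw.
by apply: rows_mean_mono; apply: row_step_ge0.
Qed.

(** The largest row with increments in {0, 1}; it is a fixed point of every row
    step, which gives the trivial bound G <= m. *)
Fixpoint stairs (c : R) m : seq R :=
  if m is m'.+1 then c + 1 :: stairs (c + 1) m' else [::].

Lemma size_stairs c m : size (stairs c m) = m.
Proof. by elim: m c => //= m IH c; rewrite IH. Qed.

Lemma row_step_stairs c m w : size w = m ->
  row_step c (stairs c m) w = stairs c m.
Proof.
elim: m c w => [|m IH] c [|b w] //= [sw].
have -> : Num.max (c + b%:R) (c + 1) = c + 1.
  by rewrite max_r// lerD2l; case: b.
by rewrite IH.
Qed.

Lemma last_stairs c m : last c (stairs c m) = c + m%:R.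
Proof.
by elim: m c => [|m IH] c /=; rewrite ?addr0// IH -addrA -natr1 [1 + _]addrC.
Qed.

Lemma rows_mean_stairs n m :
  rows_mean n exp_last (stairs 0 m) = expR (xi * m%:R).
Proof.
elim: n => [|n IH] /=; first by rewrite /exp_last last_stairs add0r.
rewrite size_stairs -[RHS](bern_mean_cst p m) -IH.
by apply: eq_bern_mean => w sw; rewrite row_step_stairs.
Qed.

End RowsMean.

(** * Means under a geometric law *)

Section GeometricMean.
Context (R : realType) (q : R).
Implicit Types (f g : nat -> R).
Local Open Scope classical_set_scope.
Local Open Scope ring_scope.
Hypothesis q01 : 0 <= q < 1.

(** The mean of [f] under the geometric law of parameter [q].  Only linearity,
    monotonicity and the memoryless recursion [geom_mean_rec] are used. *)
Definition geom_mean f : R := limn (series (fun k => (1 - q) * q ^+ k * f k)).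

Definition bounded_seq f := exists C : R, forall k, `|f k| <= C.

Lemma bounded_seqD f g : bounded_seq f -> bounded_seq g ->
  bounded_seq (fun k => f k + g k).
Proof.
move=> [C fC] [D gD]; exists (C + D) => k.
by rewrite (le_trans (ler_normD _ _))// lerD.
Qed.

Lemma bounded_seqZ c f : bounded_seq f -> bounded_seq (fun k => c * f k).
Proof. by move=> [C fC]; exists (`|c| * C) => k; rewrite normrM ler_wpM2l. Qed.

Lemma bounded_seq_cst c : bounded_seq (fun=> c).
Proof. by exists `|c|. Qed.

Lemma bounded_seqS f : bounded_seq f -> bounded_seq (fun k => f k.+1).
Proof. by move=> [C fC]; exists C. Qed.

Lemma bounded_seq_nonincreasing f : (forall k, 0 <= f k) ->
  (forall k, f k <= f 0%N) -> bounded_seq f.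
Proof. by move=> f0 f1; exists (f 0%N) => k; rewrite ger0_norm. Qed.

Lemma geom_mean_cvg f : bounded_seq f ->
  cvgn (series (fun k => (1 - q) * q ^+ k * f k)).
Proof.
move=> [C fC]; have [q0 q1] := andP q01.
apply: normed_cvg.
apply: (@series_le_cvg _ _ (geometric ((1 - q) * C) q)).
- by move=> n; exact: normr_ge0.
- move=> n; rewrite /= mulr_ge0 ?exprn_ge0// mulr_ge0 ?subr_ge0 ?(ltW q1)//.
  exact: le_trans (fC 0%N).
- move=> n; rewrite /= !normrM normrX (ger0_norm q0) ger0_norm ?subr_ge0 ?(ltW q1)//.
  by rewrite mulrAC ler_wpM2r ?exprn_ge0// ler_wpM2l// subr_ge0 ltW.
- by apply: is_cvg_geometric_series; rewrite ger0_norm.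
Qed.

Lemma geom_meanD f g : bounded_seq f -> bounded_seq g ->
  geom_mean (fun k => f k + g k) = geom_mean f + geom_mean g.
Proof.
move=> /geom_mean_cvg cf /geom_mean_cvg cg; rewrite /geom_mean -lim_seriesD//.
by congr (limn (series _)); apply/funext => k; rewrite /= mulrDr.
Qed.

Lemma geom_meanZ c f : bounded_seq f ->
  geom_mean (fun k => c * f k) = c * geom_mean f.
Proof.
move=> /geom_mean_cvg cf; rewrite /geom_mean -[RHS]lim_seriesZ//.
by congr (limn (series _)); apply/funext => k; rewrite /= mulrCA.
Qed.

Lemma geom_mean_le f g : bounded_seq f -> bounded_seq g ->
  (forall k, f k <= g k) -> geom_mean f <= geom_mean g.
Proof.
move=> /geom_mean_cvg cf /geom_mean_cvg cg fg; apply: lim_series_le => // k.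
have [q0 q1] := andP q01.
by rewrite ler_wpM2l// mulr_ge0 ?exprn_ge0// subr_ge0 ltW.
Qed.

(** Memorylessness: a geometric variable is 0 with probability [1 - q], and
    otherwise one plus a fresh copy. *)
Lemma geom_mean_rec f : bounded_seq f ->
  geom_mean f = (1 - q) * f 0%N + q * geom_mean (fun k => f k.+1).
Proof.
move=> bf; have /geom_mean_cvg cS := bounded_seqS bf.
have cZ := is_cvg_seriesZ (k := q) cS.
rewrite /geom_mean -[q * _]lim_seriesZ//.
apply: (@cvg_lim _ _ _ _ _ _ _) => //; rewrite -cvg_shiftS /=.
set G := series _ in cZ *.
rewrite [X in X @ \oo --> _](_ : _ = (fun n => (1 - q) * f 0%N + G n)).
  by apply: cvgD => //; exact: cvg_cst.
apply/funext => n; rewrite /G /series /= big_nat_recl// expr0 mulr1; congr (_ + _).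
by apply: eq_bigr => k _; rewrite exprS [RHS](_ : _ = q * ((1 - q) * q ^+ k * f k.+1))//; ring.
Qed.

Lemma geom_mean_cst c : geom_mean (fun=> c) = c.
Proof.
have := geom_mean_rec (bounded_seq_cst c); rewrite /= => e.
have q1 : 1 - q != 0 by have [_ q1] := andP q01; rewrite subr_eq0 gt_eqF.
apply: (mulfI q1); move: e; set x := geom_mean _ => e.
by rewrite mulrBl mul1r {1}e; ring.
Qed.

Lemma bounded_seq_exp xi : 0 <= xi -> bounded_seq (fun k => expR (- (xi * k%:R))).
Proof.
move=> xi0; apply: bounded_seq_nonincreasing => k; first exact: expR_ge0.
by rewrite ler_expR mulr0 oppr0 oppr_le0 mulr_ge0.
Qed.

Lemma geom_mean_exp xi : 0 <= xi ->
  geom_mean (fun k => expR (- (xi * k%:R))) = (1 - q) / (1 - q * expR (- xi)).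
Proof.
move=> xi0; have [q0 q1] := andP q01.
have b := bounded_seq_exp xi0.
have := geom_mean_rec b; rewrite mulr0 oppr0 expR0 mulr1.
rewrite [X in q * geom_mean X](_ : _ =
    (fun k => expR (- xi) * expR (- (xi * k%:R)))); last first.
  by apply/funext => k; rewrite -expRD -natr1; congr expR; ring.
rewrite geom_meanZ// => e.
have le : q * expR (- xi) < 1.
  rewrite (le_lt_trans _ q1)// -[leRHS]mulr1 ler_wpM2l//.
  by rewrite expR_le1 oppr_le0.
have ne : 1 - q * expR (- xi) != 0 by rewrite subr_eq0 gt_eqF.
apply: (mulIf ne); rewrite mulfVK//.
by rewrite mulrBr mulr1 {1}e; ring.
Qed.

Lemma bounded_seq_bern p m (F : nat -> seq bool -> R) :
  (forall w, size w = m -> bounded_seq (F^~ w)) ->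
  bounded_seq (fun k => bern_mean p m (F k)).
Proof.
elim: m F => [|m IH] F bF /=; first exact: bF.
by apply: bounded_seqD; apply: bounded_seqZ;
  apply: (IH (fun k r => F k (_ :: r))) => w sw; apply: bF; rewrite /= sw.
Qed.

Lemma geom_mean_bern p m (F : nat -> seq bool -> R) :
  (forall w, size w = m -> bounded_seq (F^~ w)) ->
  geom_mean (fun k => bern_mean p m (F k)) =
    bern_mean p m (fun w => geom_mean (F^~ w)).
Proof.
elim: m F => [//|m IH] F bF /=.
have bc b w : size w = m -> bounded_seq (F^~ (b :: w)).
  by move=> sw; apply: bF; rewrite /= sw.
have bb b : bounded_seq (fun k => bern_mean p m (fun r => F k (b :: r))).
  exact: (bounded_seq_bern _ (F := fun k r => F k (b :: r)) (bc b)).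
rewrite geom_meanD; [|exact: bounded_seqZ..].
by rewrite !geom_meanZ// !(IH (fun k r => F k (_ :: r)) (bc _)).
Qed.

End GeometricMean.

(** * Burke's theorem *)

Section Stationary.
Context (R : realType) (p u q : R).
Implicit Types (c g x : R) (h k : seq R) (w e : seq bool) (Phi : seq R -> R).
Hypothesis p01 : 0 <= p <= 1.
Hypothesis u01 : 0 <= u <= 1.
Hypothesis q01 : 0 <= q < 1.
Hypothesis detailed_balance : p * (1 - u) = u * (1 - p) * q.

(** The heights of a row with increments [e]. *)
Definition walk c e : seq R := scanl (fun y (b : bool) => y + b%:R) c e.

Lemma size_walk c e : size (walk c e) = size e.
Proof. exact: size_scanl. Qed.

Lemma walk_shift v c e : walk (c - v) e = shift v (walk c e).
Proof. by elim: e c => //= b e IH c; rewrite addrAC IH. Qed.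

Lemma dominates_walk c c' e : c' <= c -> dominates (walk c e) (walk c' e).
Proof.
by elim: e c c' => //= b e IH c c' cc; rewrite lerD2r cc IH// lerD2r.
Qed.

Lemma dominates_shift2 v v' h k : v' <= v -> dominates h k ->
  dominates (shift v' h) (shift v k).
Proof.
by move=> vv; elim: h k => [|y h IH] [|x k] //= /andP[xy /IH->]; rewrite lerB.
Qed.

(** Along such functions the mean over a row is a nonincreasing function of the
    inflow [v], hence bounded, which is all that [geom_mean] needs. *)
Definition mono_nonneg Phi :=
  (forall h, 0 <= Phi h) /\ (forall h k, dominates h k -> Phi k <= Phi h).

Lemma mono_nonneg_cons Phi x : mono_nonneg Phi ->
  mono_nonneg (fun h => Phi (x :: h)).
Proof.
by move=> [P0 Pm]; split => // h k hk; apply: Pm; rewrite /= lexx.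
Qed.

Lemma bounded_inflow Phi g m : mono_nonneg Phi ->
  bounded_seq (fun v => bern_mean u m (fun e =>
    bern_mean p m (fun w => Phi (row_step g (walk (g - v%:R) e) w)))).
Proof.
move=> [P0 Pm]; apply: bounded_seq_nonincreasing => v.
  rewrite -(bern_mean_cst u m 0); apply: bern_mean_le => // e _.
  by rewrite -(bern_mean_cst p m 0); apply: bern_mean_le.
apply: bern_mean_le => // e se; apply: bern_mean_le => // w sw; apply: Pm.
apply: dominates_row_step => //; first by rewrite size_walk se.
by apply: dominates_walk; rewrite lerD2l lerN2 ler_nat.
Qed.

(** Burke's theorem for one row: a row of Bernoulli([u]) increments fed at the left
    with an independent geometric amount is again a row of Bernoulli([u])
    increments.  The row is read from left to right; [v] is the queue length, i.e.
    the height of the new row above the old one, and by [detailed_balance] and the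
    memoryless property it stays geometric and independent of the increments
    already read. *)
Lemma burke_row Phi g m : mono_nonneg Phi ->
  geom_mean q (fun v => bern_mean u m (fun e =>
    bern_mean p m (fun w => Phi (row_step g (walk (g - v%:R) e) w))))
  = bern_mean u m (fun e => Phi (walk g e)).
Proof.
elim: m g Phi => [|m IH] g Phi mP /=; first by rewrite geom_mean_cst.
pose X x v := bern_mean u m (fun e => bern_mean p m (fun w =>
  Phi (x :: row_step x (walk (x - v%:R) e) w))).
have geomX x : geom_mean q (X x) = bern_mean u m (fun e => Phi (x :: walk x e)).
  exact: (IH x (fun h => Phi (x :: h)) (mono_nonneg_cons x mP)).
have bX x : bounded_seq (X x).
  exact: (bounded_inflow x m (mono_nonneg_cons x mP)).
(* [Y v] is the case of an increment 1 above a weight 0: the queue serves one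
   unit if it can, and otherwise the increment is passed on. *)
pose Y v := if v is v'.+1 then X g v' else X (g + 1) 0%N.
have bY : bounded_seq Y.
  have [C XC] := bX g; exists (Num.max C `|X (g + 1) 0%N|) => -[|v] /=.
    by rewrite le_max lexx orbT.
  by rewrite le_max XC.
rewrite [X in geom_mean q X](_ : _ = (fun v =>
    (u * p * X (g + 1) v + u * (1 - p) * Y v)
    + ((1 - u) * p * X (g + 1) v.+1 + (1 - u) * (1 - p) * X g v))); last first.
  apply/funext => v; rewrite !bern_meanD !bern_meanZ.
  have -> : Num.max (g + 1) (g - v%:R + 1) = g + 1.
    by rewrite max_l// lerD2r gerBl.
  have -> : Num.max (g + 1) (g - v%:R + 0) = g + 1.
    by rewrite max_l// addr0 lerD2l (le_trans _ ler01)// oppr_le0.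
  have -> : Num.max (g + 0) (g - v%:R + 0) = g.
    by rewrite !addr0 max_l// gerBl.
  have -> : g - v%:R + 1 = g + 1 - v%:R by ring.
  have -> : g - v%:R + 0 = g + 1 - v.+1%:R by rewrite -natr1; ring.
  have -> : Y v = bern_mean u m (fun r => bern_mean p m (fun r0 =>
      Phi (Num.max (g + 0) (g + 1 - v%:R)
        :: row_step (Num.max (g + 0) (g + 1 - v%:R)) (walk (g + 1 - v%:R) r) r0))).
    case: v => [|v] /=; rewrite /X.
      by rewrite !addr0 subr0 max_r// lerDl.
    have -> : g + 1 - v.+1%:R = g - v%:R by rewrite -natr1; ring.
    by rewrite addr0 max_l// gerBl.
  rewrite /X; have -> : g + 1 - v.+1%:R = g - v%:R by rewrite -natr1; ring.
  ring.
have bZ := @bounded_seqZ R; have bD := @bounded_seqD R.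
have bXS := bounded_seqS (bX (g + 1)).
rewrite !geom_meanD; do ?[exact: bZ|exact: bD|by []|apply: bD; exact: bZ].
rewrite !geom_meanZ//.
have eX : geom_mean q (X (g + 1)) = (1 - q) * X (g + 1) 0%N
    + q * geom_mean q (fun v => X (g + 1) v.+1) by rewrite -geom_mean_rec.
have eY : geom_mean q Y = (1 - q) * X (g + 1) 0%N + q * geom_mean q (X g).
  by rewrite geom_mean_rec.
rewrite addr0 -!geomX.
have -> : (1 - u) * p * geom_mean q (fun v => X (g + 1) v.+1)
   = u * (1 - p) * (geom_mean q (X (g + 1)) - (1 - q) * X (g + 1) 0%N).
  rewrite eX [X in _ * (X - _)]addrC addrK mulrA -detailed_balance; ring.
rewrite eY.
have -> : u * (1 - p) * ((1 - q) * X (g + 1) 0%N + q * geom_mean q (X g))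
  = u * (1 - p) * (1 - q) * X (g + 1) 0%N + p * (1 - u) * geom_mean q (X g).
  by rewrite detailed_balance; ring.
ring.
Qed.

End Stationary.

(** * Comparison with the stationary model *)

Section Comparison.
Context (R : realType) (p u q xi : R).
Implicit Types (c g x : R) (h k : seq R) (w e : seq bool) (Phi : seq R -> R).
Hypothesis p01 : 0 <= p <= 1.
Hypothesis u01 : 0 <= u <= 1.
Hypothesis q01 : 0 <= q < 1.
Hypothesis detailed_balance : p * (1 - u) = u * (1 - p) * q.
Hypothesis xi0 : 0 <= xi.

Let beta := geom_mean q (fun v => expR (- (xi * v%:R))).

Let beta_ge0 : 0 <= beta.
Proof.
rewrite -(geom_mean_cst q01 0); apply: geom_mean_le => //.
- exact: bounded_seq_cst.
- exact: bounded_seq_exp.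
Qed.

(** The mean of [exp_last] after [n] rows, where each row receives an
    independent geometric amount at its left end and heights are counted from the
    moving left boundary. *)
Fixpoint fed_mean n h : R :=
  if n is n'.+1 then
    geom_mean q (fun v => bern_mean p (size h) (fun w =>
      fed_mean n' (row_step 0 (shift v%:R h) w)))
  else exp_last xi h.

Lemma bounded_fed_row Phi h : mono_nonneg Phi ->
  bounded_seq (fun v => bern_mean p (size h) (fun w =>
    Phi (row_step 0 (shift v%:R h) w))).
Proof.
move=> [P0 Pm]; apply: bounded_seq_nonincreasing => v.
  by rewrite -[leLHS](bern_mean_cst p (size h) 0); apply: bern_mean_le.
apply: bern_mean_le => // w sw; apply: Pm.
apply: dominates_row_step => //; first by rewrite size_shift.
by apply: dominates_shift2; [rewrite ler_nat|exact: dominates_refl].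
Qed.

Lemma mono_nonneg_fed_mean n : mono_nonneg (fed_mean n).
Proof.
elim: n => [|n IH]; split => [h|h k hk] /=.
- exact: expR_ge0.
- by rewrite ler_expR ler_wpM2l// dominates_last.
- rewrite -[leLHS](geom_mean_cst q01 0); apply: geom_mean_le => //.
  + exact: bounded_seq_cst.
  + exact: (bounded_fed_row h IH).
  + move=> v; rewrite -[leLHS](bern_mean_cst p (size h) 0).
    by apply: bern_mean_le => // w _; apply: IH.1.
- apply: geom_mean_le => //; [exact: (bounded_fed_row k IH)|exact: (bounded_fed_row h IH)|move=> v].
  rewrite (dominates_size hk); apply: bern_mean_le => // w sw.
  apply: IH.2; apply: dominates_row_step => //.
    by rewrite size_shift (dominates_size hk).
  exact: dominates_shift2.
Qed.

(** By [burke_row], Bernoulli([u]) increments are preserved, so the mean is the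
    moment generating function of a binomial variable, for every number of rows. *)
Lemma fed_mean_walk n m :
  bern_mean u m (fun e => fed_mean n (walk 0 e)) = (1 - u + u * expR xi) ^+ m.
Proof.
elim: n => [|n IH] /=.
  suff H c : bern_mean u m (fun e => expR (xi * last c (walk c e)))
      = expR (xi * c) * (1 - u + u * expR xi) ^+ m.
    by rewrite /exp_last H mulr0 expR0 mul1r.
  elim: m c => [|m IH] c /=; first by rewrite mulr1.
  by rewrite !IH addr0 mulrDr mulr1 expRD exprS; ring.
rewrite -IH -(burke_row p01 u01 q01 detailed_balance 0 m (mono_nonneg_fed_mean n)).
rewrite [RHS](geom_mean_bern q01); last first.
  move=> e se; have := bounded_fed_row (walk 0 e) (mono_nonneg_fed_mean n).
  rewrite size_walk se; congr bounded_seq; apply/funext => v.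
  by rewrite walk_shift.
apply: eq_bern_mean => e se; congr (geom_mean q _); apply/funext => v.
by rewrite size_walk se walk_shift.
Qed.

(** Each geometric inflow only raises the heights, at the price of moving the
    origin up by the same amount; averaging that price gives a factor [beta]. *)
Lemma fed_mean_ge n h :
  beta ^+ n * rows_mean p n (exp_last xi) h <= fed_mean n h.
Proof.
elim: n h => [|n IH] h; first by rewrite mul1r.
have bf := bounded_fed_row h (mono_nonneg_fed_mean n).
rewrite exprSr -mulrA [beta * _]mulrC {2}/beta -geom_meanZ//; last first.
  exact: bounded_seq_exp.
rewrite -geom_meanZ//; last by apply: bounded_seqZ; exact: bounded_seq_exp.
apply: geom_mean_le => //.
  by do 2! apply: bounded_seqZ; exact: bounded_seq_exp.
move=> v; apply: (@le_trans _ _ (beta ^+ n * rows_mean p n.+1 (exp_last xi) (shift v%:R h))).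
  rewrite ler_wpM2l ?exprn_ge0// mulrC rows_mean_ge//.
  exact: dominates_refl.
rewrite /= size_shift -bern_meanZ; apply: bern_mean_le => // w sw; exact: IH.
Qed.

(** Last exit from the left boundary: an optimal path either starts from the
    initial row, or leaves the boundary with [l.+1] rows left, after which the
    boundary grows on the remaining [l] rows without it. *)
Lemma fed_mean_le n h :
  fed_mean n h <= beta ^+ n * rows_mean p n (exp_last xi) h
    + \sum_(l < n) beta ^+ l * rows_mean p l.+1 (exp_last xi) (flat R (size h)).
Proof.
elim: n h => [|n IH] h; first by rewrite mul1r big_ord0 addr0.
set S := \sum_(l < n) beta ^+ l * rows_mean p l.+1 (exp_last xi) (flat R (size h)).
set D0 := rows_mean p n.+1 (exp_last xi) (flat R (size h)).
set D := rows_mean p n.+1 (exp_last xi) h.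
have bf := bounded_fed_row h (mono_nonneg_fed_mean n).
have be : bounded_seq (fun v : nat => beta ^+ n * D * expR (- (xi * v%:R))).
  by apply: bounded_seqZ; exact: bounded_seq_exp.
rewrite big_ord_recr -/D0 /= -/S.
have -> : beta ^+ n.+1 * D + (S + beta ^+ n * D0) =
  geom_mean q (fun v => beta ^+ n * D * expR (- (xi * v%:R)) + (S + beta ^+ n * D0)).
  rewrite geom_meanD//; last exact: bounded_seq_cst.
  rewrite geom_meanZ ?geom_mean_cst//; last exact: bounded_seq_exp.
  by rewrite -/beta exprSr; ring.
apply: geom_mean_le => //; first by apply: bounded_seqD => //; exact: bounded_seq_cst.
move=> v; apply: (@le_trans _ _
    (beta ^+ n * rows_mean p n.+1 (exp_last xi) (shift v%:R h) + S)).
  rewrite /= -bern_meanZ size_shift -[S](bern_mean_cst p (size h)) -bern_meanD.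
  apply: bern_mean_le => // w sw.
  have := IH (row_step 0 (shift v%:R h) w).
  by rewrite size_row_step ?size_shift.
rewrite addrC [leRHS]addrCA lerD2l.
rewrite -mulrA -mulrDr ler_wpM2l ?exprn_ge0// [D * _]mulrC.
apply: rows_mean_le_add => //.
by apply: below_max_id; rewrite size_shift size_nseq.
Qed.

Lemma dominates_walk_flat c e : 0 <= c ->
  dominates (walk c e) (flat R (size e)).
Proof.
elim: e c => //= b e IH c c0.
by rewrite addr_ge0//=; apply: IH; exact: addr_ge0.
Qed.

Lemma dominates_stairs_walk c c' e : c' <= c ->
  dominates (stairs c (size e)) (walk c' e).
Proof.
elim: e c c' => //= b e IH c c' cc.
have cb : c' + b%:R <= c + 1 by rewrite lerD//; case: b.
by rewrite cb/=; exact: IH.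
Qed.

(** The stationary row lies above the zero row. *)
Lemma rows_mean_flat_le n m :
  beta ^+ n * rows_mean p n (exp_last xi) (flat R m)
    <= (1 - u + u * expR xi) ^+ m.
Proof.
rewrite -(fed_mean_walk n) -[leLHS](bern_mean_cst u m).
apply: bern_mean_le => // e se; apply: le_trans (fed_mean_ge n (walk 0 e)).
rewrite ler_wpM2l ?exprn_ge0//; apply: rows_mean_mono => //.
by rewrite -se; exact: dominates_walk_flat.
Qed.

(** The initial row is bounded by [stairs], whose contribution is
    [expR (xi * m%:R)]; damped by [beta ^+ n], it will be negligible. *)
Lemma le_sum_rows_mean n m :
  (1 - u + u * expR xi) ^+ m <= beta ^+ n * expR (xi * m%:R)
    + \sum_(l < n) beta ^+ l * rows_mean p l.+1 (exp_last xi) (flat R m).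
Proof.
rewrite -(fed_mean_walk n) -[leRHS](bern_mean_cst u m).
apply: bern_mean_le => // e se; apply: le_trans (fed_mean_le n (walk 0 e)) _.
rewrite size_walk se lerD2r ler_wpM2l ?exprn_ge0//.
rewrite -(rows_mean_stairs p xi n m); apply: rows_mean_mono => //.
by rewrite -se; exact: dominates_stairs_walk.
Qed.

End Comparison.

(** * The growth rates of the stationary model *)

Section Rates.
Context (R : realType) (p xi : R).
Hypothesis p0 : 0 < p.
Hypothesis p1 : p < 1.
Hypothesis xi0 : 0 <= xi.
Implicit Types (u s t : R).

(** The numbers [vslope], [hslope], [vgap] and [vnum] are the coefficients of the
    two rates below: [1 + hslope * u] is the moment generating function at [xi] of a
    Bernoulli([u]) variable, and [vnum u / (u - p)] is the inverse of the one at
    [- xi] of a geometric variable of parameter [p * (1 - u) / (u * (1 - p))]. *)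
Definition vslope := 1 - p * (1 - expR (- xi)).
Definition hslope := expR xi - 1.
Definition vgap := p * (1 - p) * (1 - expR (- xi)).
Definition vnum u := vslope * u - p * expR (- xi).
(** The stationary model has exponential growth rate [hrate u] per column and
    [vrate u] per row. *)
Definition hrate u := ln (1 + hslope * u).
Definition vrate u := ln (vnum u / (u - p)).

Let e0 : 0 < expR (- xi). Proof. exact: expR_gt0. Qed.
Let e1 : expR (- xi) <= 1. Proof. by rewrite expR_le1 oppr_le0. Qed.
Lemma hslope_ge0 : 0 <= hslope. Proof. by rewrite subr_ge0 -[1]expR0 ler_expR. Qed.
Lemma vgap_ge0 : 0 <= vgap.
Proof. by rewrite mulr_ge0 ?subr_ge0// mulr_ge0 ?subr_ge0// ltW. Qed.

Lemma vslope_gt0 : 0 < vslope.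
Proof.
rewrite /vslope; have := mulr_gt0 p0 e0; rewrite mulrBr mulr1 opprB addrA.
by have := p1; lra.
Qed.

Lemma vnumE u : vnum u = vslope * (u - p) + vgap.
Proof. by rewrite /vnum /vgap /vslope; ring. Qed.

Lemma vnum_gt0 u : p < u -> 0 < vnum u.
Proof.
move=> pu; by rewrite vnumE ltr_pwDl ?vgap_ge0// mulr_gt0 ?vslope_gt0// subr_gt0.
Qed.

Lemma hnum_gt0 u : 0 <= u -> 0 < 1 + hslope * u.
Proof. by move=> u0; rewrite ltr_pwDl// mulr_ge0// hslope_ge0. Qed.

Lemma ler_lnB (x y : R) : 0 < x -> 0 < y -> ln x - ln y <= (x - y) / y.
Proof.
move=> x0 y0; rewrite -ln_div ?posrE// mulrBl divff ?gt_eqF//.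
have := @le_ln1Dx R (x / y - 1); rewrite [1 + _]addrC subrK; apply.
by rewrite ltrBDl subrr divr_gt0.
Qed.

Lemma hrate_le u u' : 0 <= u -> 0 <= u' ->
  hrate u' - hrate u <= hslope * (u' - u) / (1 + hslope * u).
Proof.
move=> uge u'ge; apply: le_trans (ler_lnB _ _) _; rewrite ?hnum_gt0//.
by rewrite ler_wpM2r ?invr_ge0 ?(ltW (hnum_gt0 _))//; lra.
Qed.

Lemma vrate_le u u' : p < u -> p < u' ->
  vrate u - vrate u' <= vgap * (u' - u) / (vnum u' * (u - p)).
Proof.
move=> pu pu'; have v := vnum_gt0 pu; have v' := vnum_gt0 pu'.
have d : 0 < u - p by lra.
have d' : 0 < u' - p by lra.
apply: le_trans (ler_lnB _ _) _; rewrite ?divr_gt0//.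
rewrite le_eqVlt; apply/orP; left; apply/eqP.
rewrite !vnumE in v v' *; field.
by rewrite !gt_eqF.
Qed.

(** A finite-difference form of the derivative of [s * hrate u + t * vrate u],
    from [ln x - ln y <= (x - y) / y] for each logarithm. *)
Lemma cost_diff s t u u' : 0 <= s -> 0 <= t -> p < u -> p < u' ->
  (u' - u) * (s * (hslope / (1 + hslope * u')) - t * (vgap / (vnum u' * (u - p))))
    <= (s * hrate u' + t * vrate u') - (s * hrate u + t * vrate u).
Proof.
move=> s0 t0 pu pu'.
have h := hrate_le (ltW (lt_trans p0 pu')) (ltW (lt_trans p0 pu)).
have v := vrate_le pu pu'.
have : s * (hrate u - hrate u') <= s * (hslope * (u - u') / (1 + hslope * u')) by rewrite ler_wpM2l.
have : t * (vrate u - vrate u') <= t * (vgap * (u' - u) / (vnum u' * (u - p))) by rewrite ler_wpM2l.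
lra.
Qed.

Lemma cost_nondecreasing s t u u' : 0 <= s -> 0 <= t -> p < u -> u <= u' ->
  t * (vgap * (1 + hslope * u')) <= s * (hslope * vnum u' * (u - p)) ->
  s * hrate u + t * vrate u <= s * hrate u' + t * vrate u'.
Proof.
move=> s0 t0 pu uu' le; rewrite -subr_ge0.
have pu' := lt_le_trans pu uu'.
apply: le_trans (cost_diff s0 t0 pu pu'); rewrite mulr_ge0 ?subr_ge0//.
have v' := vnum_gt0 pu'; have h' := hnum_gt0 (ltW (lt_trans p0 pu')).
have d : 0 < u - p by lra.
rewrite [s * _]mulrA [t * _]mulrA ler_pdivrMr ?mulr_gt0// mulrAC ler_pdivlMr//; lra.
Qed.

(** The hypothesis says that the cost [s * hrate u + t * vrate u] increases at
    [u]. *)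
Lemma exists_cheaper_left s t u : 0 < s -> 0 <= t -> p < u ->
  t * (vgap * (1 + hslope * u)) < s * (hslope * vnum u * (u - p)) ->
  exists u', [/\ p < u', u' < u &
    s * hrate u' + t * vrate u' < s * hrate u + t * vrate u].
Proof.
move=> s0 t0 pu lt.
have v := vnum_gt0 pu; have h := hnum_gt0 (ltW (lt_trans p0 pu)).
have d : 0 < u - p by lra.
pose x := t * (vgap * (1 + hslope * u)) ; pose y := s * (hslope * vnum u).
have lt' : x < y * (u - p) by rewrite /x /y; lra.
have x0 : 0 <= x by rewrite /x mulr_ge0// mulr_ge0 ?vgap_ge0// ltW.
have y0 : 0 < y by rewrite -(pmulr_lgt0 _ d) (le_lt_trans x0).
pose u' := p + (x / y + (u - p)) / 2.
have xy : x / y < u - p by rewrite ltr_pdivrMr// mulrC.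
have xy0 : 0 <= x / y by rewrite divr_ge0// ltW.
have pu' : p < u' by rewrite /u'; lra.
have u'u : u' < u by rewrite /u'; lra.
exists u'; split => //; rewrite -subr_gt0.
apply: lt_le_trans (cost_diff (ltW s0) t0 pu' pu).
rewrite mulr_gt0 ?subr_gt0// [s * _]mulrA [t * _]mulrA ltr_pdivrMr; last by rewrite mulr_gt0// subr_gt0.
rewrite mulrAC ltr_pdivlMr//.
have : x < y * (u' - p).
  rewrite mulrC -ltr_pdivrMr// /u'; lra.
rewrite /x /y; lra.
Qed.

(** The hypothesis says that the cost [s * hrate u + t * vrate u] decreases at
    [u]. *)
Lemma exists_cheaper_right s t u : 0 < s -> 0 <= t -> p < u -> u < 1 -> 0 < hslope ->
  s * (hslope * vnum u * (u - p)) < t * (vgap * (1 + hslope * u)) ->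
  exists u', [/\ u < u', u' <= 1 &
    s * hrate u' + t * vrate u' < s * hrate u + t * vrate u].
Proof.
move=> s0 t0 pu u1 g0 lt.
have v := vnum_gt0 pu; have h := hnum_gt0 (ltW (lt_trans p0 pu)).
have d : 0 < u - p by lra.
pose x := t * (vgap * (1 + hslope * u)) ; pose y := s * (hslope * vnum u).
have lt' : y * (u - p) < x by rewrite /x /y; lra.
have y0 : 0 < y by rewrite /y !mulr_gt0.
have xy : u - p < x / y by rewrite ltr_pdivlMr// mulrC.
pose u' := Num.min 1 (p + (x / y + (u - p)) / 2).
have uu' : u < u' by rewrite /u' lt_min u1 /=; lra.
have u'1 : u' <= 1 by rewrite /u' ge_min lexx.
exists u'; split => //.
have pu' : p < u' by lra.
have := cost_diff (ltW s0) t0 pu' pu.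
have : 0 < (u - u') * (s * (hslope / (1 + hslope * u)) - t * (vgap / (vnum u * (u' - p)))).
  rewrite nmulr_rgt0 ?subr_lt0// [s * _]mulrA [t * _]mulrA.
  rewrite ltr_pdivlMr; last by rewrite mulr_gt0// subr_gt0.
  rewrite mulrAC ltr_pdivrMr//.
  have : y * (u' - p) < x.
    rewrite mulrC -ltr_pdivlMr//.
    have : u' <= p + (x / y + (u - p)) / 2 by rewrite /u' ge_min lexx orbT.
    lra.
  rewrite /x /y; lra.
lra.
Qed.

Lemma hrate_ge0 u : 0 <= u -> 0 <= hrate u.
Proof. by move=> u0; rewrite ln_ge0// lerDl mulr_ge0// hslope_ge0. Qed.

Lemma hrate1 : hrate 1 = xi.
Proof. by rewrite /hrate mulr1 /hslope addrC subrK expRK. Qed.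

Lemma vrate1 : vrate 1 = 0.
Proof.
have e : vnum 1 = 1 - p by rewrite /vnum /vslope; ring.
by rewrite /vrate e divff ?ln1// subr_eq0 gt_eqF.
Qed.

Lemma vrate_gt0 u : p < u -> u < 1 -> 0 < hslope -> 0 < vrate u.
Proof.
move=> pu u1 g0; rewrite ln_gt0// ltr_pdivlMr ?subr_gt0// mul1r.
have e : expR (- xi) < 1.
  by rewrite expR_lt1 oppr_lt0; rewrite subr_gt0 expR_gt1 in g0.
have : 0 < p * (1 - expR (- xi)) * (1 - u) by rewrite !mulr_gt0// subr_gt0.
rewrite /vnum /vslope; lra.
Qed.

Lemma vrate_ge0 u : p < u -> u <= 1 -> 0 <= vrate u.
Proof.
move=> pu u1; rewrite ln_ge0// ler_pdivlMr ?subr_gt0// mul1r.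
have : 0 <= p * (1 - expR (- xi)) * (1 - u).
  by rewrite !mulr_ge0// ?subr_ge0// ltW.
rewrite /vnum /vslope; lra.
Qed.

Let q u := p * (1 - u) / (u * (1 - p)).

Lemma inflow_ratio u : p < u -> u <= 1 ->
  [/\ 0 <= u <= 1, 0 <= q u < 1 & p * (1 - u) = u * (1 - p) * q u].
Proof.
move=> pu u1; have u0 := lt_trans p0 pu.
have d : 0 < u * (1 - p) by rewrite mulr_gt0// subr_gt0.
split; first by rewrite u1 ltW.
- have := p1; rewrite /q => p1'; apply/andP; split.
    by rewrite divr_ge0 ?(ltW d)// mulr_ge0 ?subr_ge0 ?(ltW p0).
  rewrite ltr_pdivrMr// mul1r; lra.
- by rewrite [RHS]mulrC /q divfK ?gt_eqF.
Qed.

Lemma geom_mean_vrate u : p < u -> u <= 1 ->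
  geom_mean (q u) (fun v => expR (- (xi * v%:R))) = expR (- vrate u).
Proof.
move=> pu u1; have [_ q01 _] := inflow_ratio pu u1.
have v := vnum_gt0 pu; have u0 := lt_trans p0 pu.
have d : 0 < u - p by lra.
rewrite geom_mean_exp// expRN lnK ?posrE ?divr_gt0//.
have eq : 1 - q u * expR (- xi) = vnum u / (u * (1 - p)).
  by rewrite /q /vnum /vslope; field; rewrite !gt_eqF ?subr_gt0.
rewrite eq /q; rewrite /vnum in v *; field.
by rewrite !gt_eqF// subr_gt0.
Qed.

Lemma expR_hrate u m : 0 <= u ->
  (1 - u + u * expR xi) ^+ m = expR (m%:R * hrate u).
Proof.
move=> u0; rewrite expRM_natl lnK ?posrE ?hnum_gt0//.
by congr (_ ^+ _); rewrite /hslope; ring.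
Qed.

Lemma rows_mean_upper u n m : p < u -> u <= 1 ->
  rows_mean p n (exp_last xi) (flat R m)
    <= expR (m%:R * hrate u + n%:R * vrate u).
Proof.
move=> pu u1; have [u01 q01 bal] := inflow_ratio pu u1.
have p01 : 0 <= p <= 1 by rewrite !ltW.
have := rows_mean_flat_le p01 u01 q01 bal xi0 n m.
rewrite geom_mean_vrate// expR_hrate; last by case/andP: u01.
rewrite -expRM_natl mulrN expRN mulrC ler_pdivrMr ?expR_gt0//.
by rewrite -expRD.
Qed.

Lemma rows_mean_lower u n m : p < u -> u <= 1 ->
  expR (m%:R * hrate u) <= expR (xi * m%:R - n%:R * vrate u)
    + \sum_(l < n) expR (- (l%:R * vrate u))
        * rows_mean p l.+1 (exp_last xi) (flat R m).
Proof.
move=> pu u1; have [u01 q01 bal] := inflow_ratio pu u1.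
have p01 : 0 <= p <= 1 by rewrite !ltW.
have := le_sum_rows_mean p01 u01 q01 bal xi0 n m.
rewrite geom_mean_vrate// expR_hrate; last by case/andP: u01.
rewrite expRD -mulrN [expR (n%:R * _)]expRM_natl [expR (xi * _) * _]mulrC.
by under eq_bigr do rewrite -expRM_natl mulrN.
Qed.

End Rates.

(** * Exponential growth from below *)

Section Growth.
Context (R : realType).
Local Open Scope classical_set_scope.
Local Open Scope ring_scope.

(** From [expR y >= 1 + y ^+ 2 / 2]. *)
Lemma near_linear_exp_le (C c e : R) : 0 < c -> 0 < e ->
  \forall N \near \oo, C * N.+1%:R * expR (- (c * N%:R)) <= e.
Proof.
move=> c0 e0; near=> N.
have N1 : 1 <= N%:R :> R by rewrite ler1n; near: N; exact: nbhs_infty_gt.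
have NC : 4 * `|C| / (e * c ^+ 2) <= N%:R by near: N; exact: nbhs_infty_ger.
have ec : 0 < e * c ^+ 2 by rewrite mulr_gt0// exprn_gt0.
rewrite ler_pdivrMr// in NC.
rewrite expRN ler_pdivrMr ?expR_gt0//.
have le : 1 + (c * N%:R) ^+ 2 / 2 <= expR (c * N%:R).
  by apply: (@expR_ge1Dxn _ _ 1); rewrite mulr_ge0// ltW.
apply: le_trans (ler_wpM2l (ltW e0) le).
apply: (@le_trans _ _ (`|C| * (2 * N%:R))).
  apply: (@le_trans _ _ (`|C| * N.+1%:R)); first by rewrite ler_wpM2r// ler_norm.
  by rewrite ler_wpM2l// -natr1; lra.
have : 4 * `|C| * N%:R <= N%:R * (e * c ^+ 2) * N%:R by rewrite ler_wpM2r.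
rewrite exprMn; lra.
Unshelve. all: by end_near. Qed.

Context (p xi : R).
Hypothesis p0 : 0 < p.
Hypothesis p1 : p < 1.
Hypothesis xi_gt0 : 0 < xi.
Implicit Types (u s t : R).

Let xi0 : 0 <= xi := ltW xi_gt0.

Lemma hslope_gt0 : 0 < hslope xi.
Proof. by rewrite subr_gt0 expR_gt1. Qed.

Lemma hrate_nondecreasing u u' : 0 <= u -> u <= u' -> hrate xi u <= hrate xi u'.
Proof.
move=> u0 uu'; rewrite -subr_le0.
apply: le_trans (hrate_le xi0 (le_trans u0 uu') u0) _.
rewrite mulr_le0_ge0 ?invr_ge0 ?(ltW (hnum_gt0 xi0 _)) ?(le_trans u0)//.
by rewrite mulr_ge0_le0 ?hslope_ge0// subr_le0.
Qed.

Lemma vrate_nonincreasing u u' : p < u -> u <= u' -> vrate p xi u' <= vrate p xi u.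
Proof.
move=> pu uu'; rewrite -subr_le0; have pu' := lt_le_trans pu uu'.
apply: le_trans (vrate_le p0 p1 xi0 pu' pu) _.
rewrite mulr_le0_ge0 ?invr_ge0//.
  by rewrite mulr_ge0_le0 ?vgap_ge0// subr_le0.
by rewrite mulr_ge0 ?(ltW (vnum_gt0 p0 p1 xi0 pu))// subr_ge0 ltW.
Qed.

(** The matching lower bound.  If [u] lies strictly between the minimizers of the
    costs for [t0] and for [t], then in [rows_mean_lower] the terms with fewer than
    [N * t0] rows are exponentially small by [rows_mean_upper] at a smaller
    parameter [v], and those with more than [N * t] rows by the same bound at a
    larger parameter [w].  The middle terms are all bounded by the largest number of
    rows, and they must carry the whole sum. *)
Lemma rows_mean_growth s t0 t u : 0 < s -> 0 <= t0 -> 0 <= t -> p < u -> u < 1 ->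
  t0 * (vgap p xi * (1 + hslope xi * u))
    < s * (hslope xi * vnum p xi u * (u - p)) ->
  s * (hslope xi * vnum p xi u * (u - p))
    < t * (vgap p xi * (1 + hslope xi * u)) ->
  exists2 C : R, 0 < C & \forall N \near \oo,
    expR (N%:R * (s * hrate xi u + t0 * vrate p xi u)) <=
    C * N.+1%:R * rows_mean p (Num.truncn (N%:R * t)).+1 (exp_last xi)
                    (flat R (Num.truncn (N%:R * s))).
Proof.
move=> s0 t00 tge0 pu u1 lt_t0 lt_t.
have [v [pv vu cv]] := exists_cheaper_left p0 p1 xi0 s0 t00 pu lt_t0.
have [w [uw w1 cw]] := exists_cheaper_right p0 p1 xi0 s0 tge0 pu u1 hslope_gt0 lt_t.
have pw : p < w := lt_trans pu uw.
have u0 : 0 <= u by rewrite ltW// (lt_trans p0).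
have v0 : 0 <= v by rewrite ltW// (lt_trans p0).
have v1 : v <= 1 by rewrite ltW// (lt_trans vu).
have ha : 0 <= hrate xi u by exact: hrate_ge0.
have hb : 0 < vrate p xi u by apply: vrate_gt0 => //; exact: hslope_gt0.
have av := hrate_nondecreasing v0 (ltW vu).
have aw := hrate_nondecreasing u0 (ltW uw).
have bv := vrate_nonincreasing pv (ltW vu).
have bw := vrate_nonincreasing pu (ltW uw).
have Dv := fun n m => rows_mean_upper p0 p1 xi0 n m pv v1.
have Dw := fun n m => rows_mean_upper p0 p1 xi0 n m pw w1.
have low := fun n m => rows_mean_lower p0 p1 xi0 n m pu (ltW u1).
move: cv cw ha hb av aw bv bw Dv Dw low.
set a := hrate xi u; set b := vrate p xi u.
set av := hrate xi v; set bv := vrate p xi v.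
set aw := hrate xi w; set bw := vrate p xi w.
move=> cv cw a0 b0 av_le aw_ge bv_ge bw_le Dv Dw low.
pose c1 := s * a + t0 * b - (s * av + t0 * bv).
pose c2 := s * a + t * b - (s * aw + t * bw).
have c10 : 0 < c1 by rewrite subr_gt0.
have c20 : 0 < c2 by rewrite subr_gt0.
(* With [n] = [K * N.+1] rows the initial row contributes at most expR (- N). *)
pose K := (Num.truncn ((xi * s + 1) / b)).+1.
have Kb : xi * s + 1 <= K%:R * b.
  by rewrite -ler_pdivrMr// ltW// truncnS_gt.
exists (2 * K%:R * expR (a + b)).
  by rewrite mulr_gt0 ?expR_gt0// mulr_gt0// ltr0n.
near=> N.
have small1 : K%:R * expR (b + (a - av)) * N.+1%:R * expR (- (c1 * N%:R)) <= 6^-1.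
  by near: N; apply: near_linear_exp_le => //; rewrite invr_gt0.
have small2 : K%:R * expR b * N.+1%:R * expR (- (c2 * N%:R)) <= 6^-1.
  by near: N; apply: near_linear_exp_le => //; rewrite invr_gt0.
have small3 : 1 * N.+1%:R * expR (- (1 * N%:R)) <= 6^-1 :> R.
  by near: N; apply: near_linear_exp_le => //; rewrite invr_gt0.
set m := Num.truncn (N%:R * s); set L := (Num.truncn (N%:R * t)).+1.
pose L0 := Num.truncn (N%:R * t0).
have N0 : 0 <= N%:R :> R by exact: ler0n.
have m_le : m%:R <= N%:R * s by rewrite truncn_le mulr_ge0// ltW.
have m_gt : N%:R * s < m%:R + 1 by rewrite natr1 truncnS_gt.
have L_gt : N%:R * t < L%:R by exact: truncnS_gt.
have L0_le : L0%:R <= N%:R * t0 by rewrite truncn_le mulr_ge0.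
have L0_gt : N%:R * t0 < L0%:R + 1 by rewrite natr1 truncnS_gt.
set D := rows_mean p L (exp_last xi) (flat R m).
have D0 : 0 <= D by apply: rows_mean_ge0; rewrite !ltW.
pose E := expR (m%:R * a).
have E0 : 0 < E by exact: expR_gt0.
(* [T1], [T2] and [T3] bound the terms with too few rows, with too many, and
   the others; [E / 6] is more than each of the negligible parts. *)
pose T1 := E * expR (b + (a - av)) * expR (- (c1 * N%:R)).
pose T2 := E * expR b * expR (- (c2 * N%:R)).
pose T3 := expR (- (L0%:R * b)) * D.
have T10 : 0 <= T1 by rewrite /T1 /E !mulr_ge0// expR_ge0.
have T20 : 0 <= T2 by rewrite /T2 /E !mulr_ge0// expR_ge0.
have T30 : 0 <= T3 by rewrite /T3 mulr_ge0// expR_ge0.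
have term (l : nat) : expR (- (l%:R * b))
    * rows_mean p l.+1 (exp_last xi) (flat R m) <= T1 + T2 + T3.
  have [lL0|lL0] := ltnP l L0.
    apply: (@le_trans _ _ T1); last by lra.
    apply: le_trans (ler_wpM2l (expR_ge0 _) (Dv _ _)) _.
    rewrite /T1 /E -!expRD ler_expR.
    have j_le : l.+1%:R <= N%:R * t0 by apply: le_trans L0_le; rewrite ler_nat.
    have := ler_wpM2r (_ : 0 <= bv - b) j_le.
    rewrite subr_ge0 => /(_ bv_ge).
    have : (N%:R * s) * (a - av) <= (m%:R + 1) * (a - av).
      by rewrite ler_wpM2r ?subr_ge0// ltW.
    rewrite -[l.+1%:R]natr1 /c1; lra.
  have [lL|lL] := leqP l.+1 L.
    apply: (@le_trans _ _ T3); last by lra.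
    apply: ler_pM; rewrite ?expR_ge0//.
    - by apply: rows_mean_ge0; rewrite !ltW.
    - by rewrite ler_expR lerN2 ler_wpM2r ?(ltW b0)// ler_nat.
    - by apply: rows_mean_flat_nondecreasing => //; rewrite !ltW.
  apply: (@le_trans _ _ T2); last by lra.
  apply: le_trans (ler_wpM2l (expR_ge0 _) (Dw _ _)) _.
  rewrite /T2 /E -!expRD ler_expR.
  have j_ge : N%:R * t <= l.+1%:R.
    by apply: (le_trans (ltW L_gt)); rewrite ler_nat ltnW.
  have := ler_wpM2r (_ : 0 <= b - bw) j_ge.
  rewrite subr_ge0 => /(_ bw_le).
  have : m%:R * (aw - a) <= (N%:R * s) * (aw - a).
    by rewrite ler_wpM2r ?subr_ge0.
  rewrite -[l.+1%:R]natr1 /c2; lra.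
pose n := (K * N.+1)%N.
have := low n m; rewrite -/E => lowE.
have first_le : expR (xi * m%:R - n%:R * b) <= E * expR (- (1 * N%:R)).
  rewrite /E -expRD ler_expR /n natrM.
  have : xi * m%:R <= xi * (N%:R * s) by rewrite ler_wpM2l.
  have : 0 <= m%:R * a by rewrite mulr_ge0.
  have : (xi * s + 1) * N%:R <= K%:R * b * N.+1%:R.
    by apply: ler_pM => //; rewrite ?ler_nat// addr_ge0// mulr_ge0// ltW.
  lra.
have sum_le : \sum_(l < n) expR (- (l%:R * b))
      * rows_mean p l.+1 (exp_last xi) (flat R m) <= n%:R * (T1 + T2 + T3).
  apply: le_trans (ler_sum _ (fun l _ => term (nat_of_ord l))) _.
  by rewrite sumr_const card_ord mulr_natl.
have nT1 : n%:R * T1 <= E * 6^-1.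
  rewrite [leLHS](_ : _ = E * (K%:R * expR (b + (a - av)) * N.+1%:R * expR (- (c1 * N%:R)))).
    by rewrite ler_wpM2l// ltW.
  by rewrite /T1 /n natrM; ring.
have nT2 : n%:R * T2 <= E * 6^-1.
  rewrite [leLHS](_ : _ = E * (K%:R * expR b * N.+1%:R * expR (- (c2 * N%:R)))).
    by rewrite ler_wpM2l// ltW.
  by rewrite /T2 /n natrM; ring.
have first_small : E * expR (- (1 * N%:R)) <= E * 6^-1.
  rewrite ler_wpM2l ?(ltW E0)//; apply: le_trans small3.
  rewrite mul1r; apply: ler_peMl; rewrite ?expR_ge0//.
  by rewrite mul1r ler1n.
have E_le : E <= 2 * n%:R * T3 by lra.
apply: (@le_trans _ _ (expR (a + b) * (E * expR (L0%:R * b)))).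
  rewrite /E -!expRD ler_expR.
  have : (N%:R * s) * a <= (m%:R + 1) * a by rewrite ler_wpM2r// ltW.
  have : (N%:R * t0) * b <= (L0%:R + 1) * b by rewrite ler_wpM2r// ltW.
  lra.
rewrite [2 * _ * _ ]mulrC -!mulrA ler_wpM2l ?expR_ge0//.
rewrite -ler_pdivlMr ?expR_gt0// -expRN.
by apply: le_trans E_le _; rewrite le_eqVlt; apply/orP; left; apply/eqP;
  rewrite /T3 /n natrM; ring.
Unshelve. all: by end_near. Qed.

End Growth.

(** * Passage times as heights *)

Section PassageTimeHeights.
Context (R : realType) (omega : nat * nat -> bool).
Implicit Types (f : nat -> R) (bit : nat -> bool) (x j m n : nat).

Fixpoint next_height f bit x : R :=
  if x is x'.+1 then Num.max (next_height f bit x' + (bit x)%:R) (f x) else 0.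

(** [height j x] is the passage time to column [x] over the first [j] rows, so
    that row [j] carries the weights of ordinate [j - 1]. *)
Fixpoint height j : nat -> R :=
  if j is j'.+1 then next_height (height j') (fun x => omega (x, j'))
  else fun=> 0.

Lemma height0 j : height j 0 = 0.
Proof. by case: j. Qed.

Lemma height_ge0 j x : 0 <= height j x.
Proof.
case: j => //= j; elim: x => //= x IH.
by rewrite le_max (le_trans IH)// lerDl.
Qed.

Lemma height_mono j x : height j x <= height j.+1 x.
Proof. by case: x => [|x]; rewrite ?height0//= le_max lexx orbT. Qed.

Lemma path_weight_rcons v vs z : path_weight omega v (rcons vs z) =
  (path_weight omega v vs + horizontal_step (last v vs) z * omega z)%N.
Proof. by rewrite /path_weight -cats1 pairmap_cat sumn_cat /= addn0. Qed.

Lemma admissible_rcons v w vs z : admissible v w (rcons vs z) =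
  [&& admissible v (last v vs) vs,
      horizontal_step (last v vs) z || vertical_step (last v vs) z & z == w].
Proof. by rewrite /admissible rcons_path last_rcons eqxx andbT andbA. Qed.

Lemma path_weight_le_height w vs : admissible (0, 0)%N w vs ->
  (path_weight omega (0, 0)%N vs)%:R <= height w.2.+1 w.1.
Proof.
elim/last_ind: vs w => [|vs z IH] w.
  by move=> /andP[_ /eqP <-]; rewrite height0.
rewrite admissible_rcons => /and3P[/IH le step /eqP <-].
rewrite path_weight_rcons; set y := last _ vs in le step *.
have [hz|hz] := boolP (horizontal_step y z).
  move: hz => /eqP ->; rewrite mul1n natrD.
  apply: (@le_trans _ _ (height y.2.+1 y.1 + (omega (y.1.+1, y.2))%:R)).
    by rewrite lerD2r.
  by rewrite /= le_max lexx.
rewrite (negbTE hz) /= in step; move: step => /eqP ->.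
by rewrite mul0n addn0 (le_trans le)// height_mono.
Qed.

Lemma path_weight_eq_height m n : exists2 vs, admissible (0, 0)%N (m, n) vs &
  (path_weight omega (0, 0)%N vs)%:R = height n.+1 m.
Proof.
elim: n m => [|n IHn].
  elim=> [|m [vs avs wvs]]; first by exists [::].
  exists (rcons vs (m.+1, 0%N)).
    by rewrite admissible_rcons; case/andP: (avs) => _ /eqP ->;
    rewrite avs /horizontal_step !eqxx.
  rewrite path_weight_rcons natrD wvs; case/andP: (avs) => _ /eqP ->.
  rewrite /horizontal_step eqxx mul1n /= max_l//.
  by rewrite addr_ge0// (height_ge0 1 m).
elim=> [|m [vs avs wvs]].
  have [vs avs wvs] := IHn 0%N.
  exists (rcons vs (0%N, n.+1)).
    rewrite admissible_rcons; case/andP: (avs) => _ /eqP ->.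
    by rewrite avs /vertical_step !eqxx orbT.
  rewrite path_weight_rcons natrD wvs; case/andP: (avs) => _ /eqP ->.
  by rewrite !height0 add0r.
have [le|lt] := leP (height n.+1 m.+1) (height n.+2 m + (omega (m.+1, n.+1))%:R).
  exists (rcons vs (m.+1, n.+1)).
    rewrite admissible_rcons; case/andP: (avs) => _ /eqP ->.
    by rewrite avs /horizontal_step !eqxx.
  rewrite path_weight_rcons natrD wvs; case/andP: (avs) => _ /eqP ->.
  by rewrite /horizontal_step eqxx mul1n [RHS]max_l.
have {avs wvs} [vs' avs wvs] := IHn m.+1.
exists (rcons vs' (m.+1, n.+1)).
  rewrite admissible_rcons; case/andP: (avs) => _ /eqP ->.
  by rewrite avs /vertical_step !eqxx orbT.
rewrite path_weight_rcons natrD wvs; case/andP: (avs) => _ /eqP ->.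
rewrite [RHS]max_r ?ltW// /horizontal_step xpair_eqE /=.
by rewrite eqn_leq ltnn andbF mul0n addr0.
Qed.

Lemma passage_time_height m n :
  (passage_time omega (0, 0)%N (m, n))%:R = height n.+1 m.
Proof.
apply/eqP; rewrite eq_le; apply/andP; split.
  have [//|//|vs avs <-] := @passage_time_attained omega (0, 0)%N (m, n).
  exact: path_weight_le_height avs.
have [vs avs <-] := path_weight_eq_height m n.
by rewrite ler_nat; exact: passage_time_ge.
Qed.

Definition row_sites m j := [seq (x.+1, j) | x <- iota 0 m].

Lemma row_step_next_height f bit k c :
  row_step (next_height f bit k) [seq f x.+1 | x <- iota k c]
    [seq bit x.+1 | x <- iota k c] = [seq next_height f bit x.+1 | x <- iota k c].
Proof. by elim: c k => //= c IH k; rewrite -IH. Qed.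

Fixpoint run_rows n (h : seq R) (w : seq bool) :=
  if n is n'.+1 then
    run_rows n' (row_step 0 h (take (size h) w)) (drop (size h) w)
  else h.

(** The sites of [n] rows in the order in which [run_rows] consumes their bits.
    Column 0 is absent: no horizontal step ends there. *)
Fixpoint sites m j n :=
  if n is n'.+1 then row_sites m j ++ sites m j.+1 n' else [::].

Lemma size_sites m j n : size (sites m j n) = (n * m)%N.
Proof.
by elim: n j => //= n IH j; rewrite size_cat size_map size_iota IH mulSn.
Qed.

Lemma sites_ge m j n v : v \in sites m j n -> (j <= v.2)%N.
Proof.
elim: n j => //= n IH j; rewrite mem_cat => /orP[/mapP[x _ ->]//|/IH].
exact: ltnW.
Qed.

Lemma uniq_sites m j n : uniq (sites m j n).
Proof.
elim: n j => //= n IH j; rewrite cat_uniq IH andbT map_inj_uniq; last first.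
  by move=> x y [].
rewrite iota_uniq /=; apply/hasPn => v /sites_ge jv.
by apply/negP => /mapP[x _ e]; rewrite e /= ltnn in jv.
Qed.

Lemma run_rows_sites m j n :
  run_rows n [seq height j x.+1 | x <- iota 0 m] [seq omega v | v <- sites m j n]
  = [seq height (j + n) x.+1 | x <- iota 0 m].
Proof.
elim: n j => [|n IH] j /=; first by rewrite addn0.
have sz : size [seq omega v | v <- row_sites m j] = m by rewrite !size_map size_iota.
rewrite size_map size_iota map_cat take_size_cat// drop_size_cat//.
rewrite -addSnnS -IH; congr (run_rows n _ _).
rewrite /row_sites -map_comp.
exact: (row_step_next_height (height j) (fun x => omega (x, j)) 0 m).
Qed.

Lemma last_run_rows_sites m n :
  last 0 (run_rows n.+1 (flat R m) [seq omega v | v <- sites m 0 n.+1])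
  = (passage_time omega (0, 0)%N (m, n))%:R.
Proof.
have -> : flat R m = [seq height 0 x.+1 | x <- iota 0 m].
  by rewrite /= /flat; elim: m 0%N => //= m IH k; rewrite -IH.
rewrite run_rows_sites add0n passage_time_height.
case: m => [|m]; first by rewrite height0.
rewrite -(nth_last) size_map size_iota (nth_map 0%N) ?size_iota//.
by rewrite nth_iota.
Qed.

End PassageTimeHeights.

Lemma rows_mean_run_rows (R : realType) (p : R) n Phi (h : seq R) :
  rows_mean p n Phi h = bern_mean p (n * size h) (fun w => Phi (run_rows n h w)).
Proof.
elim: n h => //= n IH h; rewrite mulSn bern_mean_cat.
apply: eq_bern_mean => w sw; rewrite IH size_row_step//.
by apply: eq_bern_mean => w' _; rewrite take_size_cat// drop_size_cat.
Qed.

(** * The law of the passage time *)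

Section Cylinders.
Context (R : realType) (d : measure_display) (T : measurableType d).
Context (P : probability T R) (p : R) (omega : nat * nat -> {RV P >-> bool}).
Hypothesis iid : iid_bernoulli p omega.
Implicit Types (cs : seq (nat * nat * bool)) (S : seq (nat * nat)).
Local Open Scope classical_set_scope.
Local Open Scope ring_scope.

Definition bit_weight (b : bool) : R := if b then p else 1 - p.

Lemma measurable_bits v (B : set bool) : measurable (omega v @^-1` B).
Proof. by rewrite -[_ @^-1` _]setTI; exact: measurable_funP. Qed.

Lemma prob_bit v b : P (omega v @^-1` [set b]) = (bit_weight b)%:E.
Proof.
case: b; first by rewrite -(iid.2 v).
have -> : omega v @^-1` [set false] = ~` (omega v @^-1` [set true]).
  by apply/seteqP; split => x /=; case: (omega v x).
rewrite probability_setC; last exact: measurable_bits.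
by rewrite EFinB -(iid.2 v).
Qed.

Definition cylinder cs := [set x | all (fun c => omega c.1 x == c.2) cs].

Lemma cylinderE cs : cylinder cs =
  \bigcap_(i in [set` unzip1 cs]) (omega i @^-1` [set b | all (fun c => (c.1 == i) ==> (c.2 == b)) cs]).
Proof.
apply/seteqP; split => x /=.
  move=> /allP h i _; apply/allP => c /h /eqP <-.
  by apply/implyP => /eqP <-.
move=> h; apply/allP => c ccs.
have /h /allP/(_ _ ccs) : c.1 \in unzip1 cs by apply/mapP; exists c.
by rewrite eqxx /= eq_sym.
Qed.

Lemma prob_cylinder cs : uniq (unzip1 cs) ->
  measurable (cylinder cs) /\
  P (cylinder cs) = (\prod_(c <- cs) bit_weight c.2)%:E.
Proof.
move=> ucs; rewrite cylinderE; split.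
  apply: fin_bigcap_measurable; first exact: finite_seq.
  by move=> i _; exact: measurable_bits.
rewrite (iid.1 (unzip1 cs) (fun i => [set b | all (fun c => (c.1 == i) ==> (c.2 == b)) cs]))//.
rewrite big_map -prodEFin; apply: eq_big_seq => c ccs.
rewrite -(prob_bit c.1 c.2); congr (P _).
apply/seteqP; split => x /=.
  by move=> /allP/(_ _ ccs); rewrite eqxx /= => /eqP.
move=> ->; apply/allP => c' c'cs; apply/implyP => /eqP e.
have -> // : c' = c.
have := nth_index c ccs; have := nth_index c c'cs.
set k := index c' cs; set l := index c cs => ek el.
have ks : (k < size cs)%N by rewrite index_mem.
have ls : (l < size cs)%N by rewrite index_mem.
suff kl : k = l by move: ek; rewrite kl el.
apply/eqP.
have := @nth_uniq _ c.1 (unzip1 cs) k l.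
rewrite !size_map => /(_ ks ls ucs) <-.
by rewrite !(nth_map c)// ek el e.
Qed.

(** Induction on the list of sites, with the bits already revealed recorded in the
    cylinder [cs]: revealing one more bit splits the event in two. *)
Lemma prob_bits S cs (A : seq bool -> bool) : uniq (unzip1 cs ++ S) ->
  let E := [set x | cylinder cs x /\ A [seq omega v x | v <- S]] in
  measurable E /\
  P E = (\prod_(c <- cs) bit_weight c.2
         * bern_mean p (size S) (fun w => (A w)%:R))%:E.
Proof.
elim: S cs A => [|v S IH] cs A u /=.
  rewrite cats0 in u; have [mc pc] := prob_cylinder u.
  case: (A [::]) => /=.
    rewrite mulr1 [X in measurable X](_ : _ = cylinder cs); last first.
      by apply/seteqP; split => x //= [].
    split => //; rewrite -pc; congr (P _).
    by apply/seteqP; split => x //= [].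
  rewrite mulr0 [X in measurable X](_ : _ = set0); last first.
    by apply/seteqP; split => x //= [].
  split => //; transitivity (P set0); last by rewrite measure0.
  congr (P _).
  by apply/seteqP; split => x //= [].
have u' b : uniq (unzip1 ((v, b) :: cs) ++ S).
  move: u; rewrite /= !cat_uniq /= mem_cat !negb_or.
  by move=> /and3P[-> /andP[-> ->] /andP[-> ->]].
have [mt pt] := IH ((v, true) :: cs) (fun w => A (true :: w)) (u' true).
have [mf pf] := IH ((v, false) :: cs) (fun w => A (false :: w)) (u' false).
set Et := [set x | _] in mt pt; set Ef := [set x | _] in mf pf.
have -> : [set x | cylinder cs x /\ A (omega v x :: [seq omega v x | v <- S])]
    = Et `|` Ef.
  apply/seteqP; split => x /=; rewrite /Et /Ef /cylinder /=.
    by case: (omega v x) => -[c a]; [left|right]; rewrite c.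
  by move=> [|] [/andP[/eqP -> ->] ->].
split; first exact: measurableU.
rewrite measureU//; last first.
  apply/seteqP; split => x //=; rewrite /Et /Ef /cylinder /=.
  by move=> [[/andP[/eqP -> _] _] [/andP[/eqP]]].
rewrite [X in (X + _)%E]pt [X in (_ + X)%E]pf -EFinD !big_cons /=.
by congr EFin; ring.
Qed.

Lemma prob_passage_time (c : R) m n :
  P [set x | c <= (passage_time (fun v => omega v x) (0, 0)%N (m, n))%:R]
  = (rows_mean p n.+1 (fun h => (c <= last 0 h)%R%:R) (flat R m))%:E.
Proof.
have := @prob_bits (sites m 0 n.+1) [::]
  (fun w => c <= last 0 (run_rows n.+1 (flat R m) w)) (uniq_sites _ _ _).
move=> [_]; rewrite big_nil mul1r size_sites rows_mean_run_rows size_nseq => <-.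
congr (P _); apply/seteqP; split => x /=.
  by rewrite (last_run_rows_sites R (fun v => omega v x)) /cylinder.
by rewrite (last_run_rows_sites R (fun v => omega v x)) => -[].
Qed.

End Cylinders.

(** * From exponential moments to tails *)

Section Tails.
Context (R : realType) (p xi : R).
Hypothesis p01 : 0 <= p <= 1.
Hypothesis xi0 : 0 <= xi.
Implicit Types (h k : seq R).

Lemma rows_mean_chernoff n (c : R) h :
  rows_mean p n (fun k => (c <= last 0 k)%R%:R) h
    <= expR (- (xi * c)) * rows_mean p n (exp_last xi) h.
Proof.
rewrite -rows_meanZ; apply: rows_mean_le => // k _.
rewrite -expRD; have [ck|_] := boolP (c <= last 0 k); last exact: expR_ge0.
by rewrite -[leLHS]expR0 ler_expR addrC -mulrBr mulr_ge0// subr_ge0.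
Qed.

Lemma dominates_stairs_flat (c : R) m : 0 <= c ->
  dominates (stairs c m) (flat R m).
Proof.
elim: m c => //= m IH c c0.
by rewrite addr_ge0//=; apply: IH; exact: addr_ge0.
Qed.

Lemma last_flat m : last 0 (flat R m) = 0.
Proof. by elim: m. Qed.

Lemma dominates_trans : transitive (@dominates R).
Proof.
move=> k h l; elim: h k l => [|x h IH] [|y k] [|z l] //= /andP[yx hk] /andP[zy kl].
by rewrite (le_trans zy yx) (IH k l).
Qed.

(** From the zero row only heights between 0 and [m] are reachable: every row stays
    between the zero row and [stairs]. *)
Lemma rows_mean_le_flat m n Phi Psi :
  (forall k, 0 <= last 0 k <= m%:R -> Phi k <= Psi k) ->
  rows_mean p n Phi (flat R m) <= rows_mean p n Psi (flat R m).
Proof.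
move=> le.
suff H h : dominates h (flat R m) -> dominates (stairs 0 m) h ->
    rows_mean p n Phi h <= rows_mean p n Psi h.
  apply: H; first exact: dominates_refl.
  exact: dominates_stairs_flat.
elim: n h => [|n IH] h hf sh /=.
  apply: le; have := dominates_last (lexx 0) hf; have := dominates_last (lexx 0) sh.
  rewrite last_stairs add0r => ->.
  by rewrite last_flat => ->.
have sz : size h = m by rewrite (dominates_size hf) size_nseq.
rewrite sz; apply: bern_mean_le => // w sw; apply: IH.
  have := dominates_row_step (lexx 0) _ hf => /(_ w).
  rewrite sw sz => /(_ erefl) le1.
  have le2 := row_step_ge0 R sw.
  exact: dominates_trans le1 le2.
rewrite -(row_step_stairs 0 sw); apply: dominates_row_step => //.
by rewrite size_stairs.
Qed.

(** The levels are [M * i / K] with [i < K], so the top level [M] itself is never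
    used: at [r = s] the rate function is given by continuity only. *)
Lemma exp_last_le_levels (K : nat) (M : R) k : (0 < K)%N -> 0 < M ->
  0 <= last 0 k <= M ->
  exp_last xi k <= \sum_(i < K) expR (xi * (M * i.+1%:R / K%:R))
                     * (M * i%:R / K%:R <= last 0 k)%R%:R.
Proof.
move=> K0 M0 /andP[x0 xM]; set x := last 0 k in x0 xM *.
have K0' : 0 < K%:R :> R by rewrite ltr0n.
have [i [lo hi]] : exists i : 'I_K, M * i%:R / K%:R <= x /\ x <= M * i.+1%:R / K%:R.
  have y0 : 0 <= x * K%:R / M by rewrite divr_ge0 ?mulr_ge0// ltW.
  have [lt|ge] := ltnP (Num.truncn (x * K%:R / M)) K.
    exists (Ordinal lt) => /=; have /andP[lo hi] := truncn_itv y0.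
    rewrite ler_pdivrMr// ler_pdivlMr//.
    rewrite ler_pdivlMr// in lo; rewrite ltr_pdivrMr// in hi.
    by split; [rewrite [leLHS]mulrC|rewrite [leRHS]mulrC ltW].
  have lt : (K.-1 < K)%N by rewrite prednK.
  exists (Ordinal lt) => /=; rewrite prednK// mulfK ?gt_eqF//; split => //.
  rewrite truncn_ge_nat// ler_pdivlMr// in ge.
  have Mx : M <= x by rewrite -(ler_pM2l K0') [leRHS]mulrC.
  by apply: le_trans Mx; rewrite ler_pdivrMr// ler_wpM2l ?(ltW M0)// ler_nat leq_pred.
rewrite (bigD1 i)//= -[leLHS]addr0; apply: lerD; last first.
  by apply: sumr_ge0 => j _; rewrite mulr_ge0 ?expR_ge0.
by rewrite lo mulr1 ler_expR ler_wpM2l.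
Qed.

Lemma rows_mean_le_levels (K m n : nat) (M : R) : (0 < K)%N -> 0 < M -> m%:R <= M ->
  rows_mean p n (exp_last xi) (flat R m) <=
  \sum_(i < K) expR (xi * (M * i.+1%:R / K%:R))
     * rows_mean p n (fun k => (M * i%:R / K%:R <= last 0 k)%R%:R) (flat R m).
Proof.
move=> K0 M0 mM; under eq_bigr do rewrite -rows_meanZ.
rewrite -(rows_mean_sum p n K (fun i k => expR (xi * (M * i.+1%:R / K%:R))
  * (M * i%:R / K%:R <= last 0 k)%R%:R)).
apply: rows_mean_le_flat => k /andP[k0 km]; apply: exp_last_le_levels => //.
by rewrite k0 (le_trans km).
Qed.

End Tails.

Section LogRate.
Context (R : realType).
Local Open Scope ereal_scope.
Implicit Types (k x pr c : R).

(** When the probability vanishes the rate is [+oo]. *)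
Lemma log_rate_ge k x pr : (0 < k)%R -> (pr <= expR x)%R ->
  (- (k * x))%:E <= - k%:E * lne pr%:E.
Proof.
move=> k0 le; have [pr0|pr0] := leP pr 0%R.
  rewrite /lne pr0 lt0_muleNy ?leey//.
  by rewrite -EFinN lte_fin oppr_lt0.
rewrite lne_EFin// -EFinN -EFinM lee_fin mulNr lerN2 ler_pM2l//.
by rewrite -ler_expR lnK.
Qed.

Lemma log_rate_lt k c pr : (0 < k)%R -> c%:E < - k%:E * lne pr%:E ->
  (pr <= expR (- (c / k)))%R.
Proof.
move=> k0; have [pr0|pr0] := leP pr 0%R.
  by move=> _; rewrite (le_trans pr0)// expR_ge0.
rewrite lne_EFin// -EFinN -EFinM lte_fin mulNr => lt.
have lt' : (c / k <= - ln pr)%R by rewrite ler_pdivrMr// mulNr mulrC ltW.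
by rewrite -[leLHS]lnK ?posrE// ler_expR lerNr.
Qed.

Lemma exists_between x (y : \bar R) : x%:E < y -> exists2 c, (x < c)%R & c%:E < y.
Proof.
case: y => [y||]//.
  rewrite lte_fin => xy; exists ((x + y) / 2)%R; rewrite ?lte_fin; lra.
by move=> _; exists (x + 1)%R; rewrite ?ltry// ltrDl.
Qed.

End LogRate.

(** * The rate function *)

Section RateFunction.
Context (R : realType) (d : measure_display) (T : measurableType d).
Context (P : probability T R) (p : R) (omega : nat * nat -> {RV P >-> bool}).
Context (J : R -> R -> R -> \bar R).
Hypothesis p0 : 0 < p.
Hypothesis p1 : p < 1.
Hypothesis iid : iid_bernoulli p omega.
Hypothesis rate : right_tail_rate omega J.
Implicit Types (s t r u : R).
Local Open Scope classical_set_scope.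
Local Open Scope ring_scope.

Let p01 : 0 <= p <= 1. Proof. by rewrite !ltW. Qed.

(** Continuity is used only along sequences of the closed domain. *)
Lemma rate_cvg_seq s t r (sn tn : nat -> R) :
  0 <= s -> 0 <= t -> r <= s ->
  (forall n, [/\ 0 <= sn n, 0 <= tn n & r <= sn n]) ->
  sn @ \oo --> s -> tn @ \oo --> t ->
  (fun n => J (sn n) (tn n) r) @ \oo --> J s t r.
Proof.
move=> s0 t0 rs inA cs ct.
have /subspace_continuousP cont := right_tail_rate_continuous rate.
have := cont (s, t, r) _ => /(_ (And3 s0 t0 rs)) {}cont.
have cx : (fun n => (sn n, tn n, r)) @ \oo --> (s, t, r).
  exact: (cvg_pair (cvg_pair cs ct) (cvg_cst r)).
move=> A /cont; rewrite nbhs_simpl /within /= => nA.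
have := cx _ nA; rewrite /= !nbhs_simpl /=.
apply: filterS => n; apply.
exact: inA.
Qed.

Lemma cvg_shift_harmonic (x : R) : (fun n => x + n.+1%:R^-1) @ \oo --> x.
Proof.
rewrite -[X in _ --> X]addr0; apply: cvgD; first exact: cvg_cst.
exact: cvg_harmonic.
Qed.

(** The event [G >= N * r] is sure for [r <= 0]. *)
Lemma rate_eq0_interior s t r : 0 < s -> 0 < t -> r <= 0 -> J s t r = 0%E.
Proof.
move=> s0 t0 r0.
have c := right_tail_rate_lim rate s0 t0 (le_lt_trans r0 s0).
rewrite -(cvg_lim (@ereal_hausdorff R) c).
apply: lim_near_cst => //; apply: nearW => N.
rewrite [X in P X](_ : _ = setT); last first.
  apply/seteqP; split => x //= _; apply: le_trans (ler0n _ _).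
  by rewrite mulr_ge0_le0.
by rewrite probability_setT lne1 mule0.
Qed.

Lemma rate_eq0 s t : 0 <= s -> 0 <= t -> J s t 0 = 0%E.
Proof.
move=> s0 t0.
have inv (n : nat) : 0 < n.+1%:R^-1 :> R by rewrite invr_gt0.
have inA n : [/\ 0 <= s + n.+1%:R^-1, 0 <= t + n.+1%:R^-1 & 0 <= s + n.+1%:R^-1].
  by split; rewrite addr_ge0// ltW.
have c := rate_cvg_seq s0 t0 s0 inA (@cvg_shift_harmonic s) (@cvg_shift_harmonic t).
rewrite -(cvg_lim (@ereal_hausdorff R) c).
apply: lim_near_cst => //; apply: nearW => n.
by rewrite rate_eq0_interior// ltr_wpDl.
Qed.

End RateFunction.

(** * Bounds on the convex dual *)

Section DualBounds.
Context (R : realType) (d : measure_display) (T : measurableType d).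
Context (P : probability T R) (p : R) (omega : nat * nat -> {RV P >-> bool}).
Context (J : R -> R -> R -> \bar R) (xi : R).
Hypothesis p0 : 0 < p.
Hypothesis p1 : p < 1.
Hypothesis xi0 : 0 <= xi.
Hypothesis iid : iid_bernoulli p omega.
Hypothesis rate : right_tail_rate omega J.
Implicit Types (s t r u : R).
Local Open Scope classical_set_scope.
Local Open Scope ring_scope.

Let p01 : 0 <= p <= 1. Proof. by rewrite !ltW. Qed.

(** The exponential Markov inequality with [rows_mean_upper]. *)
Lemma rate_ge_interior s t r u : 0 < s -> 0 < t -> r < s -> p < u -> u <= 1 ->
  ((xi * r - (s * hrate xi u + t * vrate p xi u))%:E <= J s t r)%E.
Proof.
move=> s0 t0 rs pu u1.
have a0 : 0 <= hrate xi u by rewrite hrate_ge0// ltW// (lt_trans p0).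
have b0 : 0 <= vrate p xi u by exact: vrate_ge0.
set a := hrate xi u in a0 *; set b := vrate p xi u in b0 *.
have c := right_tail_rate_lim rate s0 t0 rs.
apply/lee_subgt0Pr => e e0; apply: cvge_ge c; near=> N.
have N0 : 0 < N%:R :> R by rewrite ltr0n; near: N; exact: nbhs_infty_gt.
have Ne : b / e <= N%:R by near: N; exact: nbhs_infty_ger.
rewrite ler_pdivrMr// in Ne.
set m := Num.truncn (N%:R * s); set n := Num.truncn (N%:R * t).
have m_le : m%:R <= N%:R * s by rewrite truncn_le mulr_ge0// ltW.
have n_le : n%:R <= N%:R * t by rewrite truncn_le mulr_ge0// ltW.
rewrite (prob_passage_time iid).
have iN : 0 < (N%:R)^-1 :> R by rewrite invr_gt0.
pose x := - (xi * (N%:R * r)) + (m%:R * a + n.+1%:R * b).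
have le : rows_mean p n.+1 (fun h => (N%:R * r <= last 0 h)%R%:R) (flat R m) <= expR x.
  apply: le_trans (rows_mean_chernoff p01 xi0 _ _ _) _.
  rewrite /x expRD ler_wpM2l ?expR_ge0//.
  exact: rows_mean_upper.
apply: le_trans (log_rate_ge iN le).
rewrite -EFinB lee_fin -(ler_pM2l N0) mulrN mulrA divff ?gt_eqF// mul1r.
have : m%:R * a <= N%:R * s * a by rewrite ler_wpM2r.
have : n%:R * b <= N%:R * t * b by rewrite ler_wpM2r.
rewrite /x -[n.+1%:R]natr1; lra.
Unshelve. all: by end_near. Qed.

Lemma rate_ge s t r u : 0 <= s -> 0 <= t -> r <= s -> p < u -> u <= 1 ->
  ((xi * r - (s * hrate xi u + t * vrate p xi u))%:E <= J s t r)%E.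
Proof.
move=> s0 t0 rs pu u1.
have inv (n : nat) : 0 < n.+1%:R^-1 :> R by rewrite invr_gt0.
have inA n : [/\ 0 <= s + n.+1%:R^-1, 0 <= t + n.+1%:R^-1 & r <= s + n.+1%:R^-1].
  by split; rewrite ?addr_ge0 ?(ltW (inv n))// ler_wpDr// ltW.
have c := rate_cvg_seq rate s0 t0 rs inA (@cvg_shift_harmonic R s) (@cvg_shift_harmonic R t).
have a0 : 0 <= hrate xi u by rewrite hrate_ge0// ltW// (lt_trans p0).
have b0 : 0 <= vrate p xi u by exact: vrate_ge0.
apply/lee_subgt0Pr => e e0; apply: cvge_ge c; near=> n.
have lt : (hrate xi u + vrate p xi u) / e <= n%:R by near: n; exact: nbhs_infty_ger.
rewrite ler_pdivrMr// in lt.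
apply: le_trans (rate_ge_interior (r := r) _ _ _ pu u1); last 3 first.
- by rewrite ltr_wpDl.
- by rewrite ltr_wpDl.
- by rewrite (le_lt_trans rs)// ltrDl.
rewrite -EFinB lee_fin.
have : n.+1%:R^-1 * (hrate xi u + vrate p xi u) <= e.
  by rewrite mulrC ler_pdivrMr// -natr1 mulrC; lra.
move: (n.+1%:R^-1) => i; lra.
Unshelve. all: by end_near. Qed.

(** For every parameter [u] the stationary model bounds the dual from above, up to
    the boundary of the domain. *)
Lemma dual_le s t u : 0 <= s -> 0 <= t -> p < u -> u <= 1 ->
  (convex_dual (J s t) xi <= (s * hrate xi u + t * vrate p xi u)%:E)%E.
Proof.
move=> s0 t0 pu u1; apply: ge_ereal_sup => _ [r _ <-].
have [rs|sr] := leP r s.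
  have := rate_ge s0 t0 rs pu u1; case: (J s t r) => [j||]//=.
    by rewrite -EFinB !lee_fin; lra.
  by rewrite addeNy leNye.
rewrite (right_tail_rate_pinfty rate) ?leNye//.
by move=> [_ _]; rewrite leNgt sr.
Qed.

Lemma dual_ge0 s t : 0 <= s -> 0 <= t -> (0 <= convex_dual (J s t) xi)%E.
Proof.
move=> s0 t0; apply: ereal_sup_ubound; exists 0 => //.
by rewrite (rate_eq0 rate)// mul0r sube0.
Qed.

(** Laplace's principle on [K] levels.  If the rate were too large at every level,
    the mean of [exp_last] would be exponentially smaller than
    [rows_mean_growth] allows.  The level [k.+1] in the bound is the price of the
    discretization. *)
Lemma rate_le_level s t0 t u (K : nat) : 0 < xi -> 0 < s -> 0 <= t0 -> 0 < t ->
  p < u -> u < 1 ->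
  t0 * (vgap p xi * (1 + hslope xi * u))
    < s * (hslope xi * vnum p xi u * (u - p)) ->
  s * (hslope xi * vnum p xi u * (u - p))
    < t * (vgap p xi * (1 + hslope xi * u)) ->
  (0 < K)%N -> exists k : 'I_K,
  (J s t (s * k%:R / K%:R) <= (xi * (s * k.+1%:R / K%:R)
                        - (s * hrate xi u + t0 * vrate p xi u))%:E)%E.
Proof.
move=> xi_gt0 s0 t00 tgt pu u1 lt_t0 lt_t K0.
have K0' : 0 < K%:R :> R by rewrite ltr0n.
have [C C0 growth] := rows_mean_growth p0 p1 xi_gt0 s0 t00 (ltW tgt) pu u1 lt_t0 lt_t.
set f := s * hrate xi u + _ in growth *.
apply: contrapT => /forallNP no.
pose D (Phi : R -> seq R -> R) (N : nat) (k : nat) :=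
  rows_mean p (Num.truncn (N%:R * t)).+1 (Phi (N%:R * s * k%:R / K%:R))
    (flat R (Num.truncn (N%:R * s))).
pose tail := D (fun c h => (c <= last 0 h)%R%:R).
have small (k : 'I_K) : \forall N \near \oo,
    C * N.+1%:R * (expR (xi * (N%:R * s * k.+1%:R / K%:R)) * tail N k)
      <= expR (N%:R * f) / (2 * K%:R).
  have /negP := no k; rewrite -ltNge => /exists_between[c fc cJ].
  have rs : s * k%:R / K%:R < s.
    by rewrite ltr_pdivrMr// ltr_pM2l// ltr_nat.
  have lim := right_tail_rate_lim rate s0 tgt rs.
  have near_c := lim _ (open_ereal_gt' cJ).
  pose e := c - (xi * (s * k.+1%:R / K%:R) - f).
  have e0 : 0 < e by rewrite subr_gt0.
  have K20 : 0 < (2 * K%:R)^-1 :> R by rewrite invr_gt0 mulr_gt0.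
  have near_lin := near_linear_exp_le C e0 K20.
  near=> N.
  have N0 : 0 < N%:R :> R by rewrite ltr0n; near: N; exact: nbhs_infty_gt.
  have iN : 0 < (N%:R)^-1 :> R by rewrite invr_gt0.
  have tail_le : tail N k <= expR (- (c * N%:R)).
    have : (c%:E < - (N%:R^-1)%:E * lne (P [set x | (N%:R * (s * k%:R / K%:R) <=
          (passage_time (fun v => omega v x) (0, 0)%N
             (Num.truncn (N%:R * s), Num.truncn (N%:R * t)))%:R)%R]))%E by near: N.
    rewrite (prob_passage_time iid) => /(log_rate_lt iN).
    by rewrite invrK !mulrA.
  have lin : C * N.+1%:R * expR (- (e * N%:R)) <= (2 * K%:R)^-1 by near: N.
  apply: (@le_trans _ _ (expR (N%:R * f) * (C * N.+1%:R * expR (- (e * N%:R))))); last first.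
    by rewrite ler_wpM2l// expR_ge0.
  rewrite [leRHS]mulrCA ler_wpM2l//; first by rewrite mulr_ge0// ltW.
  rewrite -expRD; apply: le_trans (ler_wpM2l (expR_ge0 _) tail_le) _.
  rewrite -expRD ler_expR le_eqVlt; apply/orP; left; apply/eqP.
  by rewrite /e; ring.
have all_small : \forall N \near \oo, forall k : 'I_K,
    C * N.+1%:R * (expR (xi * (N%:R * s * k.+1%:R / K%:R)) * tail N k)
      <= expR (N%:R * f) / (2 * K%:R) by exact: filter_forall.
near \oo => N.
have N0 : 0 < N%:R :> R by rewrite ltr0n; near: N; exact: nbhs_infty_gt.
have le : expR (N%:R * f) <= C * N.+1%:R * D (fun=> exp_last xi) N 0%N by near: N.
have leN (k : 'I_K) : C * N.+1%:R * (expR (xi * (N%:R * s * k.+1%:R / K%:R)) * tail N k)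
      <= expR (N%:R * f) / (2 * K%:R).
  by move: k; near: N.
have D_le : D (fun=> exp_last xi) N 0%N <=
    \sum_(k < K) expR (xi * (N%:R * s * k.+1%:R / K%:R)) * tail N k.
  apply: rows_mean_le_levels => //; first by rewrite mulr_gt0.
  by rewrite truncn_le mulr_ge0// ltW.
have : expR (N%:R * f) <= expR (N%:R * f) / 2.
  apply: (le_trans le); apply: (@le_trans _ _ (C * N.+1%:R *
      \sum_(k < K) expR (xi * (N%:R * s * k.+1%:R / K%:R)) * tail N k)).
    by rewrite ler_wpM2l// mulr_ge0// ltW.
  rewrite mulr_sumr; apply: le_trans (ler_sum _ (fun k _ => leN k)) _.
  rewrite sumr_const card_ord -[leLHS]mulr_natr le_eqVlt; apply/orP; left.
  by apply/eqP; field; rewrite gt_eqF.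
have := expR_gt0 (N%:R * f); lra.
Unshelve. all: by end_near. Qed.

(** A bound on the levels for all [t' > t] passes to [t] by continuity of [J], and
    the mesh [xi * s / K] of the levels tends to 0.  This covers [t = 0] as well,
    where [J] is only defined by continuity. *)
Lemma dual_ge s t y : 0 < s -> 0 <= t ->
  (forall t' K, t < t' -> (0 < K)%N -> exists k : 'I_K,
     (J s t' (s * k%:R / K%:R) <= (xi * (s * k.+1%:R / K%:R) - y)%:E)%E) ->
  (y%:E <= convex_dual (J s t) xi)%E.
Proof.
move=> s0 t0 level; rewrite leNgt; apply/negP => lt.
have [z zy dual_z] : exists2 z, z < y & (convex_dual (J s t) xi <= z%:E)%E.
  move: lt; case: (convex_dual _ _) => [x||]//.
    by rewrite lte_fin => xy; exists x.
  by exists (y - 1); rewrite ?leNye// ltrBlDr ltrDl.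
(* The mesh of the levels is smaller than the gap between [z] and [y]. *)
pose K := (Num.truncn (xi * s / (y - z))).+1.
have K0 : 0 < K%:R :> R by rewrite ltr0n.
have yz : 0 < y - z by rewrite subr_gt0.
have Kbig : xi * s / K%:R < y - z.
  by rewrite ltr_pdivrMr// [ltRHS]mulrC -ltr_pdivrMr// truncnS_gt.
have inv (n : nat) : 0 < n.+1%:R^-1 :> R by rewrite invr_gt0.
have near_k (k : 'I_K) : \forall n \near \oo,
    ((xi * (s * k.+1%:R / K%:R) - y)%:E < J s (t + n.+1%:R^-1) (s * k%:R / K%:R))%E.
  have rs : s * k%:R / K%:R <= s.
    by rewrite ler_pdivrMr// ler_pM2l// ler_nat ltnW.
  have inA n : [/\ 0 <= s, 0 <= t + n.+1%:R^-1 & s * k%:R / K%:R <= s].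
    by split; rewrite ?(ltW s0)// addr_ge0// ltW.
  have c := rate_cvg_seq rate (ltW s0) t0 rs inA (cvg_cst s) (@cvg_shift_harmonic R t).
  suff lt' : ((xi * (s * k.+1%:R / K%:R) - y)%:E < J s t (s * k%:R / K%:R))%E.
    exact: (c _ _ (open_ereal_gt' lt')).
  have : ((s * k%:R / K%:R * xi)%:E - J s t (s * k%:R / K%:R) <= z%:E)%E.
    by apply: le_trans dual_z; apply: ereal_sup_ubound; exists (s * k%:R / K%:R).
  case: (J s t _) => [j||]//=; last by rewrite ltry.
  rewrite -EFinB lee_fin lte_fin -natr1.
  have -> : xi * (s * (k%:R + 1) / K%:R) = s * k%:R / K%:R * xi + xi * s / K%:R by ring.
  lra.
have near_all : \forall n \near \oo, forall k : 'I_K,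
    ((xi * (s * k.+1%:R / K%:R) - y)%:E < J s (t + n.+1%:R^-1) (s * k%:R / K%:R))%E.
  exact: filter_forall.
near \oo => n.
have [|//|k] := level (t + n.+1%:R^-1) K; first by rewrite ltrDl.
rewrite leNgt => /negP; apply; move: k.
by near: n.
Unshelve. all: by end_near. Qed.

End DualBounds.

(** * The optimal parameter *)

Section Optimum.
Context (R : realType) (p xi s t : R).
Hypothesis p0 : 0 < p.
Hypothesis p1 : p < 1.
Hypothesis xi_gt0 : 0 < xi.
Hypothesis s0 : 0 < s.
Hypothesis t0 : 0 <= t.

Let xi0 : 0 <= xi := ltW xi_gt0.
Let c := expR xi + expR (- xi) - 2.
Let root := Num.sqrt (Delta p s t xi).
Let x := p * (1 - p) * (s + t) * c + root.

(** The larger critical point of [s * hrate u + t * vrate u], where [x] is the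
    larger root of [quadratic]; it is [p] when [t = 0]. *)
Definition optimum : R :=
  ((x + 2 * s) / (2 * s * vslope p xi) - 1) / hslope xi.

(** The coefficient of [u - v], namely [vslope + hslope * p * expR (- xi)], is 1. *)
Lemma vnum_ratio u v :
  vnum p xi u * (1 + hslope xi * v) - vnum p xi v * (1 + hslope xi * u) = u - v.
Proof.
rewrite /vnum /vslope /hslope.
have yE : expR xi = (expR (- xi))^-1 by rewrite expRN invrK.
have y0 : expR (- xi) != 0 by rewrite expR_eq0.
by rewrite yE; move: y0; set y := expR (- xi) => y0; field.
Qed.

Let cE : c = (1 - expR (- xi)) ^+ 2 / expR (- xi).
Proof.
rewrite /c -[in LHS](opprK xi) [expR (- - xi)]expRN opprK.
have y0 : expR (- xi) != 0 by rewrite expR_eq0.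
by move: y0; set y := expR (- xi) => y0; field.
Qed.

Let y_gt0 : 0 < expR (- xi). Proof. exact: expR_gt0. Qed.
Let y_lt1 : expR (- xi) < 1. Proof. by rewrite expR_lt1 oppr_lt0. Qed.

Lemma c_gt0 : 0 < c.
Proof. by rewrite cE divr_gt0// exprn_gt0// subr_gt0. Qed.

Let k := p * (1 - p) * c.
Let k_gt0 : 0 < k. Proof. by rewrite /k !mulr_gt0 ?c_gt0// subr_gt0. Qed.

Let ks_gt0 : 0 < 4 * k * s.
Proof. by apply: mulr_gt0 => //; exact: mulr_gt0. Qed.

Lemma DeltaE : Delta p s t xi = (k * (s + t)) ^+ 2 + 4 * k * s * t.
Proof. by rewrite /Delta /k /c; ring. Qed.

Lemma Delta_ge0 : 0 <= Delta p s t xi.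
Proof.
by rewrite DeltaE addr_ge0 ?sqr_ge0//; apply: mulr_ge0 => //; exact: ltW ks_gt0.
Qed.

Lemma quadratic : x ^+ 2 = 2 * k * (s + t) * x + 4 * k * s * t.
Proof.
have sq : root ^+ 2 = (k * (s + t)) ^+ 2 + 4 * k * s * t.
  by rewrite /root sqr_sqrtr ?Delta_ge0// DeltaE.
have -> : x = k * (s + t) + root by rewrite /x /k; ring.
by rewrite sqrrD sq; ring.
Qed.

Lemma hnum_optimum :
  1 + hslope xi * optimum = (x + 2 * s) / (2 * s * vslope p xi).
Proof.
have g0 := hslope_gt0 xi_gt0; rewrite /optimum mulrC divfK ?gt_eqF//; ring.
Qed.

Let a0 : 0 < vslope p xi. Proof. exact: vslope_gt0. Qed.

Lemma vnum_optimum : hslope xi * vnum p xi optimum = x / (2 * s).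
Proof.
have e : hslope xi * vnum p xi optimum = vslope p xi * (1 + hslope xi * optimum) - 1.
  rewrite /vnum /vslope /hslope.
  have yE : expR xi = (expR (- xi))^-1 by rewrite expRN invrK.
  have y0 : expR (- xi) != 0 by rewrite expR_eq0.
  by rewrite yE; move: y0; set y := expR (- xi) => y0; field.
by rewrite e hnum_optimum; field; rewrite !gt_eqF.
Qed.

Lemma gap_optimum :
  hslope xi * vslope p xi * (optimum - p) = (x - 2 * k * s) / (2 * s).
Proof.
have e : hslope xi * vslope p xi * (optimum - p)
    = vslope p xi * (1 + hslope xi * optimum) - 1 - k.
  rewrite /k cE /vslope /hslope.
  have yE : expR xi = (expR (- xi))^-1 by rewrite expRN invrK.
  have y0 : expR (- xi) != 0 by rewrite expR_eq0.
  by rewrite yE; move: y0; set y := expR (- xi) => y0; field.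
by rewrite e hnum_optimum; field; rewrite !gt_eqF.
Qed.

(** The critical point equation; multiplied by [hslope * vslope] it becomes
    [quadratic]. *)
Lemma optimum_balance : t * (vgap p xi * (1 + hslope xi * optimum))
  = s * (hslope xi * vnum p xi optimum * (optimum - p)).
Proof.
have g0 := hslope_gt0 xi_gt0.
have s2 : 2 * s != 0 by rewrite gt_eqF// mulr_gt0.
have nz : hslope xi * vslope p xi != 0 by rewrite gt_eqF// mulr_gt0.
apply: (mulfI nz).
have -> : hslope xi * vslope p xi * (s * (hslope xi * vnum p xi optimum * (optimum - p)))
  = s * (hslope xi * vnum p xi optimum) * (hslope xi * vslope p xi * (optimum - p)).
  by ring.
rewrite vnum_optimum gap_optimum hnum_optimum.
have kE : k = hslope xi * vgap p xi.
  rewrite /k cE /vgap /hslope.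
  have yE : expR xi = (expR (- xi))^-1 by rewrite expRN invrK.
  have y0 : expR (- xi) != 0 by rewrite expR_eq0.
  by rewrite yE; move: y0; set y := expR (- xi) => y0; field.
have -> : hslope xi * vslope p xi * (t * (vgap p xi * ((x + 2 * s) / (2 * s * vslope p xi))))
  = t * k * (x + 2 * s) / (2 * s).
  by rewrite kE; field; rewrite !gt_eqF.
have -> : s * (x / (2 * s)) * ((x - 2 * k * s) / (2 * s)) = (x ^+ 2 - 2 * k * s * x) / (4 * s).
  by field; rewrite gt_eqF.
by rewrite quadratic; field; rewrite gt_eqF.
Qed.

Lemma root_ge : k * (s - t) <= root /\ (0 < t -> k * (s - t) < root).
Proof.
have e : Delta p s t xi = (k * (s - t)) ^+ 2 + 4 * k * s * t * (k + 1).
  by rewrite DeltaE; ring.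
have sq : Num.sqrt ((k * (s - t)) ^+ 2) >= k * (s - t).
  by rewrite sqrtr_sqr ler_norm.
have pos := ks_gt0.
have k1 : 0 < k + 1 by rewrite addr_gt0.
split=> [|tgt].
  apply: (le_trans sq); rewrite ler_sqrt ?Delta_ge0// e lerDl.
  by rewrite mulr_ge0 ?(ltW k1)// mulr_ge0 ?(ltW pos).
apply: (le_lt_trans sq); rewrite ltr_sqrt.
  by rewrite e ltrDl mulr_gt0// mulr_gt0.
rewrite e; apply: ltr_pwDr; last exact: sqr_ge0.
by rewrite mulr_gt0// mulr_gt0.
Qed.

Lemma optimum_ge : p <= optimum /\ (0 < t -> p < optimum).
Proof.
have g0 := hslope_gt0 xi_gt0.
have pos : 0 < hslope xi * vslope p xi by rewrite mulr_gt0.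
have [ge gt] := root_ge.
have xE : x - 2 * k * s = root - k * (s - t) by rewrite /x /k; ring.
split=> [|tgt].
  rewrite -subr_ge0 -(pmulr_rge0 _ pos) gap_optimum divr_ge0 ?mulr_ge0 ?(ltW s0)//.
  by rewrite xE subr_ge0.
rewrite -subr_gt0 -(pmulr_rgt0 _ pos) gap_optimum divr_gt0 ?mulr_gt0//.
by rewrite xE subr_gt0 gt.
Qed.

End Optimum.

Section Critical.
Context (R : realType) (p xi s : R).
Hypothesis p0 : 0 < p.
Hypothesis p1 : p < 1.
Hypothesis xi_gt0 : 0 < xi.
Hypothesis s0 : 0 < s.
Implicit Types (t u v : R).

Let xi0 : 0 <= xi := ltW xi_gt0.

Let y_gt0 : 0 < expR (- xi). Proof. exact: expR_gt0. Qed.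
Let y_lt1 : expR (- xi) < 1. Proof. by rewrite expR_lt1 oppr_lt0. Qed.
Let hslopeE : hslope xi = (1 - expR (- xi)) / expR (- xi).
Proof.
have yE : expR xi = (expR (- xi))^-1 by rewrite expRN invrK.
by rewrite /hslope yE mulrBl mul1r divff ?gt_eqF.
Qed.
Let vnum1 : vnum p xi 1 = 1 - p.
Proof. by rewrite /vnum /vslope; ring. Qed.

Lemma vgap_gt0 : 0 < vgap p xi.
Proof. by rewrite /vgap !mulr_gt0// subr_gt0. Qed.

Lemma vnum_hnum u : vnum p xi u
  = ((1 - p) * (1 + hslope xi * u) + (u - 1)) * expR (- xi).
Proof.
have := vnum_ratio p xi u 1; rewrite vnum1 mulr1.
have -> : 1 + hslope xi = (expR (- xi))^-1 by rewrite expRN invrK /hslope; ring.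
move=> e; rewrite -[LHS](divfK (x := expR (- xi))) ?gt_eqF//.
by congr (_ * _); move: e; lra.
Qed.

(** At [u = 1] the critical point equation reads [t = (1 - p) / p * s], and by
    [vnum_ratio] the solution increases with [t]. *)
Lemma balanced_lt1 t v : t < (1 - p) / p * s -> p <= v ->
  t * (vgap p xi * (1 + hslope xi * v)) = s * (hslope xi * vnum p xi v * (v - p)) ->
  v < 1.
Proof.
move=> ts pv; apply: contra_eqT; rewrite -leNgt => v1; rewrite lt_eqF//.
have h0 : 0 < 1 + hslope xi * v by apply: hnum_gt0 => //; have := p0; lra.
have ts' : t * p < (1 - p) * s by move: ts; rewrite mulrAC ltr_pdivlMr.
have y1 : 0 < 1 - expR (- xi) by rewrite subr_gt0.
have pp : 0 < 1 - p by rewrite subr_gt0.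
apply: (@lt_le_trans _ _ ((1 - p) ^+ 2 * s * (1 - expR (- xi)) * (1 + hslope xi * v))).
  rewrite mulrA ltr_pM2r// /vgap.
  have : t * p * ((1 - p) * (1 - expR (- xi))) < (1 - p) * s * ((1 - p) * (1 - expR (- xi))).
    by rewrite ltr_pM2r// mulr_gt0.
  by lra.
rewrite {2}hslopeE vnum_hnum.
rewrite [leRHS](_ : _ = s * (1 - expR (- xi)) * (((1 - p) * (1 + hslope xi * v) + (v - 1)) * (v - p))); last first.
  by field; rewrite gt_eqF.
rewrite [leLHS](_ : _ = s * (1 - expR (- xi)) * ((1 - p) * (1 + hslope xi * v) * (1 - p))); last by ring.
rewrite ler_wpM2l ?mulr_ge0 ?(ltW s0) ?(ltW y1)//.
apply: ler_pM => //; rewrite ?mulr_ge0 ?(ltW pp) ?(ltW h0)//; lra.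
Qed.

Lemma steep_balance t u : (1 - p) / p * s <= t -> p < u -> u < 1 ->
  s * (hslope xi * vnum p xi u * (u - p)) <= t * (vgap p xi * (1 + hslope xi * u)).
Proof.
move=> ts pu u1.
have h0 : 0 < 1 + hslope xi * u by apply: hnum_gt0 => //; have := p0; lra.
have ts' : (1 - p) * s <= t * p by move: ts; rewrite mulrAC ler_pdivrMr.
have y1 : 0 < 1 - expR (- xi) by rewrite subr_gt0.
have pp : 0 < 1 - p by rewrite subr_gt0.
apply: (@le_trans _ _ ((1 - p) ^+ 2 * s * (1 - expR (- xi)) * (1 + hslope xi * u))); last first.
  rewrite [t * _]mulrA ler_pM2r// /vgap.
  have : (1 - p) * s * ((1 - p) * (1 - expR (- xi))) <= t * p * ((1 - p) * (1 - expR (- xi))).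
    by rewrite ler_pM2r// mulr_gt0.
  by lra.
rewrite {1}hslopeE vnum_hnum.
rewrite [leLHS](_ : _ = s * (1 - expR (- xi)) * (((1 - p) * (1 + hslope xi * u) + (u - 1)) * (u - p))); last first.
  by field; rewrite gt_eqF.
rewrite [leRHS](_ : _ = s * (1 - expR (- xi)) * ((1 - p) * (1 + hslope xi * u) * (1 - p))); last by ring.
rewrite ler_wpM2l ?mulr_ge0 ?(ltW s0) ?(ltW y1)//.
apply: (@le_trans _ _ ((1 - p) * (1 + hslope xi * u) * (u - p))).
  by apply: ler_wpM2r; lra.
by rewrite ler_wpM2l ?mulr_ge0 ?(ltW pp) ?(ltW h0)//; lra.
Qed.

(** The minimizer moves to the right when [t] increases; [M] bounds the slope of
    the left-hand side in [u]. *)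
Lemma balance_increasing t t' v : 0 <= t -> p <= v -> v < 1 -> t < t' ->
  t * (vgap p xi * (1 + hslope xi * v)) = s * (hslope xi * vnum p xi v * (v - p)) ->
  exists u, [/\ v < u, u < 1 &
    s * (hslope xi * vnum p xi u * (u - p)) < t' * (vgap p xi * (1 + hslope xi * u))].
Proof.
move=> t0 pv v1 tt' bal.
have g0 := hslope_gt0 xi_gt0.
have h0 : 0 < 1 + hslope xi * v by apply: hnum_gt0 => //; have := p0; lra.
pose eta := (t' - t) * (vgap p xi * (1 + hslope xi * v)).
have eta0 : 0 < eta by rewrite !mulr_gt0 ?vgap_gt0// subr_gt0.
pose M := s * hslope xi * 2.
have M0 : 0 < M by rewrite !mulr_gt0.
pose e := Num.min ((1 - v) / 2) (eta / (2 * M)).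
have e0 : 0 < e by rewrite lt_min !divr_gt0 ?mulr_gt0// subr_gt0.
have ev : e <= (1 - v) / 2 by rewrite ge_min lexx.
have eM : M * e <= eta / 2.
  have : e <= eta / (2 * M) by rewrite ge_min lexx orbT.
  by rewrite ler_pdivlMr ?mulr_gt0//; lra.
exists (v + e); split; [by rewrite ltrDl|by lra|].
have a0 := vslope_gt0 xi p0 p1.
have a1 : vslope p xi <= 1.
  by rewrite /vslope gerBl mulr_ge0 ?(ltW p0)// subr_ge0 ltW.
have nv : vnum p xi v <= 1.
  rewrite (_ : vnum p xi v = vnum p xi 1 - vslope p xi * (1 - v)).
    rewrite vnum1; have : 0 <= vslope p xi * (1 - v) by rewrite mulr_ge0 ?(ltW a0)// subr_ge0 ltW.
    by have := p0; lra.
  by rewrite /vnum; ring.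
apply: (@lt_le_trans _ _ (t' * (vgap p xi * (1 + hslope xi * v)))); last first.
  have t'0 : 0 <= t' by rewrite (le_trans t0)// ltW.
  rewrite ler_wpM2l// ler_wpM2l ?(ltW vgap_gt0)// lerD2l ler_wpM2l ?(ltW g0)//.
  by rewrite lerDl ltW.
have -> : t' * (vgap p xi * (1 + hslope xi * v))
    = s * (hslope xi * vnum p xi v * (v - p)) + eta by rewrite -bal /eta; ring.
have -> : s * (hslope xi * vnum p xi (v + e) * (v + e - p))
  = s * (hslope xi * vnum p xi v * (v - p))
    + s * hslope xi * ((vslope p xi * (v + e - p) + vnum p xi v) * e).
  by rewrite /vnum; ring.
rewrite ltrD2l; apply: (@le_lt_trans _ _ (M * e)); last by lra.
rewrite /M -[leRHS]mulrA ler_wpM2l ?mulr_ge0 ?(ltW s0) ?(ltW g0)//.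
rewrite ler_wpM2r ?(ltW e0)//.
have : vslope p xi * (v + e - p) <= 1 * 1.
  by apply: ler_pM; rewrite ?(ltW a0)//; have := p0; lra.
lra.
Qed.

End Critical.

(** * The value of the dual *)

Section DualValue.
Context (R : realType) (d : measure_display) (T : measurableType d).
Context (P : probability T R) (p : R) (omega : nat * nat -> {RV P >-> bool}).
Context (J : R -> R -> R -> \bar R) (xi s t : R).
Hypothesis p0 : 0 < p.
Hypothesis p1 : p < 1.
Hypothesis iid : iid_bernoulli p omega.
Hypothesis rate : right_tail_rate omega J.
Hypothesis xi0 : 0 <= xi.
Hypothesis t0 : 0 <= t.

(** The upper bound at [u = 1], where both rates vanish for [xi = 0]. *)
Lemma dual_at_0 : 0 <= s -> convex_dual (J s t) 0 = 0%E.
Proof.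
move=> s0; apply/eqP; rewrite eq_le (dual_ge0 _ rate)// andbT.
apply: le_trans (dual_le p0 p1 (lexx 0) iid rate s0 t0 p1 (lexx 1)) _.
by rewrite hrate1 vrate1// !mulr0 addr0.
Qed.

(** The cost is decreasing up to [u = 1], where it equals [s * xi].  The lower
    bound uses [t0 = 0] and lets [u] tend to 1. *)
Lemma dual_steep : 0 <= s -> (1 - p) / p * s <= t ->
  convex_dual (J s t) xi = (s * xi)%:E.
Proof.
move=> s0 ts; have [xi_gt0|] := ltP 0 xi; last first.
  move=> le0; have -> : xi = 0 by apply/eqP; rewrite eq_le le0 xi0.
  by rewrite dual_at_0// mulr0.
apply/eqP; rewrite eq_le; apply/andP; split.
  apply: le_trans (dual_le p0 p1 xi0 iid rate s0 t0 p1 (lexx 1)) _.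
  by rewrite hrate1 vrate1// mulr0 addr0.
have [s_gt0|] := ltP 0 s; last first.
  move=> le0; have -> : s = 0 by apply/eqP; rewrite eq_le le0 s0.
  by rewrite mul0r (dual_ge0 _ rate).
have g0 := hslope_gt0 xi_gt0.
have key u : p < u -> u < 1 -> ((s * hrate xi u)%:E <= convex_dual (J s t) xi)%E.
  move=> pu u1; apply: (dual_ge rate) => // t' K tt' K0.
  have t'0 : 0 < t' := le_lt_trans t0 tt'.
  have u0 : 0 <= u by rewrite ltW// (lt_trans p0).
  have v := vnum_gt0 p0 p1 xi0 pu; have h := hnum_gt0 xi0 u0.
  have kap := vgap_gt0 p0 p1 xi_gt0.
  have [||k Jk] := @rate_le_level _ _ _ _ _ _ J xi p0 p1 xi0 iid rate
      s 0 t' u K xi_gt0 s_gt0 (lexx 0) t'0 pu u1 _ _ K0.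
  - by rewrite mul0r !mulr_gt0// subr_gt0.
  - apply: (le_lt_trans (steep_balance p0 p1 xi_gt0 s_gt0 ts pu u1)).
    by rewrite ltr_pM2r// mulr_gt0.
  by exists k; rewrite mul0r addr0 in Jk.
apply/lee_subgt0Pr => e e0.
pose w := Num.min ((1 - p) / 2) (e / (s * hslope xi)).
have w0 : 0 < w by rewrite lt_min !divr_gt0 ?mulr_gt0// subr_gt0.
have wp : w <= (1 - p) / 2 by rewrite ge_min lexx.
have we : w * (s * hslope xi) <= e.
  by rewrite -ler_pdivlMr ?mulr_gt0// ge_min lexx orbT.
have pu : p < 1 - w by have := p1; lra.
apply: le_trans (key (1 - w) pu _); last by lra.
rewrite -EFinB lee_fin.
have u0 : 0 <= 1 - w by rewrite ltW// (lt_trans p0).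
have h1 : 1 <= 1 + hslope xi * (1 - w) by rewrite lerDl mulr_ge0// ltW.
have := hrate_le xi0 u0 (ler01 : 0 <= 1 :> R); rewrite hrate1 => le.
have : hslope xi * (1 - (1 - w)) / (1 + hslope xi * (1 - w)) <= hslope xi * w.
  rewrite ler_pdivrMr ?(lt_le_trans _ h1)// -[leLHS]mulr1 subKr.
  by rewrite ler_wpM2l// mulr_ge0 ?ltW.
move=> le2; have := ler_wpM2l s0 (le_trans le le2); lra.
Qed.

(** The cost has its minimum at [optimum].  When [t = 0] the optimum is [p], where
    [vrate] has a pole, and the upper bound is reached as [u] decreases to [p]. *)
Lemma dual_shallow : 0 < xi -> t < (1 - p) / p * s -> 0 < s ->
  convex_dual (J s t) xi =
    (s * hrate xi (optimum p xi s t) + t * vrate p xi (optimum p xi s t))%:E.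
Proof.
move=> xi_gt0 ts s0.
have bal := optimum_balance p0 p1 xi_gt0 s0 t0.
have [pv pv_gt] := optimum_ge p0 p1 xi_gt0 s0 t0.
have v1 := balanced_lt1 p0 p1 xi_gt0 s0 ts pv bal.
set v := optimum p xi s t in bal pv pv_gt v1 *.
have g0 := hslope_gt0 xi_gt0.
have v0 : 0 <= v by rewrite ltW// (lt_le_trans p0).
have hv := hnum_gt0 xi0 v0.
have ratio u : v < u -> vnum p xi v * (1 + hslope xi * u) < vnum p xi u * (1 + hslope xi * v).
  by move=> vu; rewrite -subr_gt0 vnum_ratio subr_gt0.
have bal_le u : v < u -> t * (vgap p xi * (1 + hslope xi * u))
    <= s * (hslope xi * vnum p xi u * (v - p)).
  move=> vu; rewrite -(ler_pM2r hv).
  have -> : t * (vgap p xi * (1 + hslope xi * u)) * (1 + hslope xi * v)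
    = s * hslope xi * (v - p) * (vnum p xi v * (1 + hslope xi * u)).
    transitivity (t * (vgap p xi * (1 + hslope xi * v)) * (1 + hslope xi * u)).
      by ring.
    by rewrite bal; ring.
  rewrite [leRHS](_ : _ = s * hslope xi * (v - p) * (vnum p xi u * (1 + hslope xi * v))); last by ring.
  by rewrite ler_wpM2l ?(ltW (ratio _ vu))// !mulr_ge0 ?(ltW s0) ?(ltW g0)// subr_ge0.
apply/eqP; rewrite eq_le; apply/andP; split.
  have [tgt|] := ltP 0 t.
    exact: (dual_le p0 p1 xi0 iid rate (ltW s0) t0 (pv_gt tgt) (ltW v1)).
  move=> le0; have tz : t = 0 by apply/eqP; rewrite eq_le le0 t0.
  apply/lee_addgt0Pr => e e0.
  pose w := Num.min (1 - v) (e / (s * hslope xi)).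
  have w0 : 0 < w by rewrite lt_min divr_gt0 ?mulr_gt0// subr_gt0 v1.
  have wv : w <= 1 - v by rewrite ge_min lexx.
  have we : w * (s * hslope xi) <= e.
    by rewrite -ler_pdivlMr ?mulr_gt0// ge_min lexx orbT.
  have pu : p < v + w by rewrite (le_lt_trans pv)// ltrDl.
  have u1 : v + w <= 1 by lra.
  apply: le_trans (dual_le p0 p1 xi0 iid rate (ltW s0) t0 pu u1) _.
  rewrite -EFinD lee_fin tz !mul0r !addr0.
  have u0 : 0 <= v + w by lra.
  have le := hrate_le xi0 v0 u0.
  have : hslope xi * (v + w - v) / (1 + hslope xi * v) <= hslope xi * w.
    rewrite ler_pdivrMr// addrAC subrr add0r -[leLHS]mulr1.
    by rewrite ler_wpM2l ?mulr_ge0 ?(ltW g0) ?(ltW w0)// lerDl mulr_ge0// ltW.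
  move=> le2; have := ler_wpM2l (ltW s0) (le_trans le le2); lra.
apply: (dual_ge rate) => // t' K tt' K0.
have [u [vu u1 bal']] := balance_increasing p0 p1 xi_gt0 s0 t0 pv v1 tt' bal.
have pu := le_lt_trans pv vu.
have bal_lt : t * (vgap p xi * (1 + hslope xi * u))
    < s * (hslope xi * vnum p xi u * (u - p)).
  apply: (le_lt_trans (bal_le _ vu)).
  rewrite ltr_pM2l// ltr_pM2l; first by rewrite ltrD2r.
  by rewrite mulr_gt0// vnum_gt0.
have [k Jk] := @rate_le_level _ _ _ _ _ _ J xi p0 p1 xi0 iid rate
  s t t' u K xi_gt0 s0 t0 (le_lt_trans t0 tt') pu u1 bal_lt bal' K0.
exists k; apply: le_trans Jk _; rewrite lee_fin lerB//.
have [tgt|] := ltP 0 t.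
  by apply: cost_nondecreasing (ltW s0) t0 (pv_gt tgt) (ltW vu) (bal_le _ vu).
move=> le0; have tz : t = 0 by apply/eqP; rewrite eq_le le0 t0.
rewrite tz !mul0r !addr0 ler_wpM2l ?(ltW s0)//.
by apply: hrate_nondecreasing => //; exact: ltW.
Qed.

End DualValue.

(* The argument of the second logarithm is 0 / 0 at xi = 0, where it tends to 1,
   and has a zero denominator at t = 0, where the logarithm is multiplied by 0.
   As x / 0 = 0 and ln 0 = 0 here, the second term is then 0, as intended. *)
Theorem theorem4p2 (R : realType) (d : measure_display) (T : measurableType d)
    (P : probability T R) (p : R) (omega : nat * nat -> {RV P >-> bool})
    (J : R -> R -> R -> \bar R) (xi s t : R)
    (hp0 : 0 < p) (hp1 : p < 1)
    (homega : iid_bernoulli p omega)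
    (hJ : right_tail_rate omega J)
    (hxi : 0 <= xi) (hs : 0 <= s) (ht : 0 <= t) :
  (t < (1 - p) / p * s ->
     convex_dual (J s t) xi =
     (s * ln ((p * (1 - p) * (s + t) * (expR xi + expR (- xi) - 2) + 2 * s
                 + Num.sqrt (Delta p s t xi))
              / (2 * s * (1 - p * (1 - expR (- xi)))))
      + t * ln ((p * (1 - p) * (s + t) * (expR xi + expR (- xi) - 2)
                   + Num.sqrt (Delta p s t xi)) * (1 - p * (1 - expR (- xi)))
                / (p * (1 - p) * (t - s) * (expR xi + expR (- xi) - 2)
                   + Num.sqrt (Delta p s t xi))))%:E)
  /\
  ((1 - p) / p * s <= t -> convex_dual (J s t) xi = (s * xi)%:E).
Proof.
split; last exact: (dual_steep hp0 hp1 homega hJ hxi ht hs).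
move=> ts.
have s0 : 0 < s.
  rewrite lt_neqAle hs andbT; apply/eqP => sz; move: ts; rewrite -sz mulr0.
  by rewrite ltNge ht.
have [xi_gt0|] := ltP 0 xi; last first.
  move=> le0; have -> : xi = 0 by apply/eqP; rewrite eq_le le0 hxi.
  rewrite (dual_at_0 hp0 hp1 homega hJ)// /Delta oppr0 expR0.
  rewrite [1 + 1 - 2](_ : _ = 0); last by ring.
  rewrite !(mulr0, mul0r, sqrtr0, add0r, addr0, subrr, subr0, mulr1).
  by rewrite divff ?gt_eqF ?mulr_gt0// ln1 ln0// !mulr0 addr0.
rewrite (dual_shallow hp0 hp1 homega hJ)//.
congr (_%:E); congr (_ * _ + _).
  rewrite /hrate hnum_optimum// /vslope.
  by congr (ln (_ / _)); rewrite -!addrA; congr (_ + _); rewrite addrC.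
have [tgt|] := ltP 0 t; last first.
  move=> le0; have -> : t = 0 by apply/eqP; rewrite eq_le le0 ht.
  by rewrite !mul0r.
congr (_ * ln _).
have [_ /(_ tgt) pv] := optimum_ge hp0 hp1 xi_gt0 s0 ht.
have g0 := hslope_gt0 xi_gt0; have a0 := vslope_gt0 xi hp0 hp1.
have vp : 0 < optimum p xi s t - p by rewrite subr_gt0.
have gap : hslope xi * vslope p xi * (optimum p xi s t - p)
    = (p * (1 - p) * (t - s) * (expR xi + expR (- xi) - 2)
       + Num.sqrt (Delta p s t xi)) / (2 * s).
  by rewrite gap_optimum//; congr (_ / _); ring.
have nz : (p * (1 - p) * (t - s) * (expR xi + expR (- xi) - 2)
       + Num.sqrt (Delta p s t xi)) != 0.
  have : 0 < hslope xi * vslope p xi * (optimum p xi s t - p) by rewrite !mulr_gt0.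
  by rewrite gap; apply: contraTneq => ->; rewrite mul0r ltxx.
have -> : vnum p xi (optimum p xi s t) / (optimum p xi s t - p)
  = hslope xi * vnum p xi (optimum p xi s t) * vslope p xi
    / (hslope xi * vslope p xi * (optimum p xi s t - p)).
  by field; rewrite !gt_eqF.
rewrite gap vnum_optimum// -/(vslope p xi); field.
by rewrite nz gt_eqF.
Qed.
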